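(* Let $\dim(\mathcal{X})<\infty$. Then $E_{\mathcal{Z}^*}\subseteq \mathcal{U}_d$, where $$\mathcal{U}_d=\{(\alpha_1x^*\otimes x,\ldots,\alpha_dx^*\otimes x):(\alpha_1,\ldots,\alpha_d)\in S_{\ell_q^d},\ x^*\in E_{\mathcal{X}^*},\ x\in E_{\mathcal{X}},\ x^*(x)=1\}.$$
   Context: $\mathcal{X}$ is a nonzero Banach space over $\mathbb{F}$ ($\mathbb{R}$ or $\mathbb{C}$) with dual $\mathcal{X}^*$. For a normed space $\mathcal{Y}$, $B_{\mathcal{Y}}$ is its closed unit ball, $S_{\mathcal{Y}}$ its unit sphere, and $E_{\mathcal{Y}}$ the set of extreme points of $B_{\mathcal{Y}}$. $\mathcal{L}(\mathcal{X})$ is the space of bounded linear operators on $\mathcal{X}$; $\Pi=\{(x,x^* ): x\in S_{\mathcal{X}},\ x^*\in S_{\mathcal{X}^*},\ x^*(x)=1\}$. Standing assumption: the numerical radius $w(T)=\sup\{|x^*(Tx)|:(x,x^* )\in\Pi\}$ is a norm on $\mathcal{L}(\mathcal{X})$ (automatic if $\mathbb{F}=\mathbb{C}$). Fix an integer $d\ge 1$ and $1<p<\infty$, and let $\frac1p+\frac1q=1$. The joint numerical radius of $\mathcal{T}=(T_1,\ldots,T_d)\in\mathcal{L}(\mathcal{X})^d$ is $w_p(\mathcal{T})=\sup\{(\sum_{i=1}^d|x^*(T_ix)|^p)^{1/p}:(x,x^* )\in\Pi\}$, and $\mathcal{Z}=(\mathcal{L}(\mathcal{X})^d,w_p(\cdot))$,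 with dual $\mathcal{Z}^*$ carrying the dual norm. $\ell_q^d$ is $\mathbb{F}^d$ with the $q$-norm. For $\alpha_i\in\mathbb{F}$, $x\in\mathcal{X}$, $x^*\in\mathcal{X}^*$, $(\alpha_1x^*\otimes x,\ldots,\alpha_dx^*\otimes x)$ denotes the linear functional $(T_1,\ldots,T_d)\mapsto\sum_{i=1}^d\alpha_i x^*(T_ix)$ on $\mathcal{L}(\mathcal{X})^d$. *)

(* Defs.v *)
From HB Require Import structures.
From mathcomp Require Import all_boot all_order all_algebra.
From mathcomp Require Import all_classical all_reals all_analysis.
From mathcomp Require Import complex.

Set Implicit Arguments.
Unset Strict Implicit.
Unset Printing Implicit Defensive.

Import Order.TTheory GRing.Theory Num.Theory.
Import numFieldNormedType.Exports.

Local Open Scope classical_set_scope.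
Local Open Scope ring_scope.

Variant real_or_complex (R : realType) : numFieldType -> Type :=
| RealScalars : real_or_complex R R
| ComplexScalars : real_or_complex R R[i].

(* The norm of a [normedModType K] takes its values in [K]; over the complex
   numbers these values are complex numbers with zero imaginary part. [rnorm]
   is the same norm, read as an element of [R]. *)
Definition real_part (R : realType) (K : numFieldType)
    (F : real_or_complex R K) : K -> R :=
  match F in real_or_complex _ K' return K' -> R with
  | RealScalars => fun x => x
  | ComplexScalars => fun z => complex.Re z
  end.

Definition rnorm (R : realType) (K : numFieldType) (F : real_or_complex R K)
    (V : normedZmodType K) (v : V) : R := real_part F `|v|.

Definition finite_dimensional (K : numFieldType) (V : lmodType K) : Prop :=
  exists (n : nat) (e : 'I_n -> V),
    forall v : V, exists c : 'I_n -> K, v = \sum_(i < n) c i *: e i.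

Section bounded_operators.
Variables (K : numFieldType) (X : normedModType K).

Definition bounded_linear : {pred (X -> X)} :=
  [pred T : X -> X |
    `[< linear T /\ exists M : K, forall x, `|T x| <= M * `|x| >]].

Lemma bounded_linear_submod : submod_closed bounded_linear.
Proof.
split => [|a f g].
  apply/asboolP; split => [b u v|]; first by rewrite /= scaler0 addr0.
  by exists 0 => x; rewrite mul0r normr0.
move=> /asboolP[lf [M hM]] /asboolP[lg [N hN]]; apply/asboolP; split.
  move=> b u v; rewrite /= !fctE lf lg !scalerDr !scalerA [a * b]mulrC.
  by rewrite addrACA.
exists (`|a| * M + N) => x; rewrite mulrDl -mulrA.
apply: le_trans (ler_normD _ _) _; apply: lerD => //.
by rewrite normrZ ler_wpM2l.
Qed.

HB.instance Definition _ :=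
  GRing.isSubmodClosed.Build K (X -> X) bounded_linear bounded_linear_submod.

Record bounded_op := BoundedOp {
  bounded_op_fun :> X -> X;
  bounded_op_prop : bounded_op_fun \in bounded_linear }.

HB.instance Definition _ := [isSub for bounded_op_fun].
HB.instance Definition _ := [Choice of bounded_op by <:].
HB.instance Definition _ := [SubChoice_isSubLmodule of bounded_op by <:].

End bounded_operators.

(* Norms and duals for an arbitrary function [N : V -> R], so that the same
   definitions apply to [X] with its own norm and to the space of [d]-tuples
   of operators with [w_p]. *)
Section normed_spaces.
Variables (R : realType) (K : numFieldType) (F : real_or_complex R K).
Variables (V : lmodType K) (N : V -> R).

Definition is_norm : Prop :=
  [/\ forall u v, N (u + v) <= N u + N v,
      forall (a : K) v, N (a *: v) = rnorm F a * N v
    & forall v, N v = 0 -> v = 0].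

Definition dual : set (V -> K^o) :=
  [set f | linear f /\ exists C : R, forall v, rnorm F (f v) <= C * N v].

Definition dual_norm (f : V -> K^o) : R :=
  sup [set rnorm F (f v) | v in [set v | N v <= 1]].

Definition dual_sphere : set (V -> K^o) :=
  [set f | dual f /\ dual_norm f = 1].

Definition dual_ball : set (V -> K^o) :=
  [set f | dual f /\ dual_norm f <= 1].

Definition unit_ball : set V := [set v | N v <= 1].

End normed_spaces.

(* In [R[i]], the condition [0 < t < 1] forces [t] to be real. *)
Definition extreme_points (K : numFieldType) (V : lmodType K) (B : set V) :
    set V :=
  [set x | B x /\ forall (y z : V) (t : K), B y -> B z -> 0 < t < 1 ->
     x = t *: y + (1 - t) *: z -> y = x /\ z = x].

Section numerical_radius.
Variables (R : realType) (K : numFieldType) (F : real_or_complex R K).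
Variables (X : normedModType K) (d : nat).

Definition lp_norm (p : R) (a : 'I_d -> K) : R :=
  (\sum_(i < d) (rnorm F (a i)) `^ p) `^ p^-1.

Definition Pi_states : set (X * (X -> K^o)) :=
  [set xf | [/\ rnorm F xf.1 = 1, dual_sphere F (rnorm F (V:=X)) xf.2
              & xf.2 xf.1 = 1]].

Definition numerical_radius (T : bounded_op X) : R :=
  sup [set rnorm F (xf.2 (T xf.1)) | xf in Pi_states].

Definition joint_numerical_radius (p : R) (T : 'I_d -> bounded_op X) : R :=
  sup [set lp_norm p (fun i => xf.2 (T i xf.1)) | xf in Pi_states].

(* (a_1 f (x) x, ..., a_d f (x) x), acting on [d]-tuples of operators *)
Definition tensor_functional (a : 'I_d -> K) (f : X -> K^o) (x : X) :
    ('I_d -> bounded_op X) -> K^o :=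
  fun T => \sum_(i < d) a i * f (T i x).

Definition U_d (q : R) : set (('I_d -> bounded_op X) -> K^o) :=
  [set phi | exists (a : 'I_d -> K) (f : X -> K^o) (x : X),
    [/\ lp_norm q a = 1,
        extreme_points (dual_ball F (rnorm F (V:=X))) f,
        extreme_points (unit_ball (rnorm F (V:=X))) x,
        f x = 1
      & phi = tensor_functional a f x]].

End numerical_radius.

Arguments numerical_radius {R K} F X T.
Arguments joint_numerical_radius {R K} F X d p T.
Arguments U_d {R K} F X d q.

(* Main.v *)
From HB Require Import structures.
Require Import Defs.
From mathcomp Require Import all_boot all_order all_algebra.
From mathcomp Require Import all_classical all_reals all_analysis.
From mathcomp Require Import complex ring lra.
Import Order.TTheory GRing.Theory Num.Theory.
Import numFieldNormedType.Exports.
Local Open Scope classical_set_scope.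
Local Open Scope ring_scope.

(** The joint numerical radius is the supremum, over the states [(x, f)], of the
    seminorms sending [T] to the p-norm of the tuple of scalars [f (T i x)]. An
    extreme point [phi] of the dual ball of such a supremum is already dominated
    by a single one of these seminorms. Indeed, suppose that [phi] is dominated
    by the maximum of two seminorms [N1] and [N2] below the radius. Extending
    [phi] from the diagonal of the square of the space, where it is dominated by
    the maximum of [N1] of the first and [N2] of the second component, writes it
    as a convex combination of a functional dominated by [N1] and one dominated
    by [N2] ([dominated_by_max_split]); by extremality [phi] is dominated by
    [N1] or by [N2]. So if the states are divided into two sets, the supremum
    over one of them dominates [phi], and hence there is an ultrafilter of
    sets of states with this property ([extreme_ultrafilter]). This replaces the
    separation and convex hull arguments behind Milman's converse of the
    Krein-Milman theorem. In finite dimension the ultrafilter converges to a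
    state, and [phi] is dominated by the seminorm of the limit
    ([extreme_dominated_by_state]).

    A functional dominated by the seminorm of the state [(x, f)] depends on [T]
    only through the scalars [f (T i x)], so it is a tensor functional with some
    coefficient tuple [a] ([tensor_of_state_dominated]). Hoelder's inequality
    and its case of equality show that [a] has q-norm at most one, and
    extremality that it has q-norm one. Finally, a proper convex decomposition
    of [f] or of [x] in its unit ball consists of functionals or points that
    take the value one against [x] or [f], so it induces a decomposition of
    [phi] in the dual ball. That decomposition is trivial, and evaluating it at
    operators of rank one shows that the decomposition of [f] or of [x] was
    trivial. *)

Set Implicit Arguments.
Unset Strict Implicit.
Unset Printing Implicit Defensive.

(** * Real and complex scalars *)

Definition emb (R : realType) (K : numFieldType) (F : real_or_complex R K) :
    R -> K :=
  match F in real_or_complex _ K' return R -> K' with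
  | RealScalars => fun r => r
  | ComplexScalars => fun r => (r%:C)%C
  end.

Section scalars.
Context {R : realType} {K : numFieldType} {F : real_or_complex R K}.

Lemma emb_is_additive : zmod_morphism (emb F).
Proof. by case: F => // x y; rewrite /= rmorphB. Qed.

Lemma emb_is_multiplicative : monoid_morphism (emb F).
Proof. by case: F; split => //= x y; rewrite rmorphM. Qed.

HB.instance Definition _ :=
  GRing.isZmodMorphism.Build R K (emb F) emb_is_additive.
HB.instance Definition _ :=
  GRing.isMonoidMorphism.Build R K (emb F) emb_is_multiplicative.

Lemma real_part_is_additive : zmod_morphism (real_part F).
Proof. by case: F => //= -[a b] [c d]. Qed.

HB.instance Definition _ :=
  GRing.isZmodMorphism.Build K R (real_part F) real_part_is_additive.

Lemma real_part_emb r : real_part F (emb F r) = r.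
Proof. by case: F. Qed.

Lemma real_part_embM r x : real_part F (emb F r * x) = r * real_part F x.
Proof. by case: F x => //= -[a b] /=; rewrite mul0r subr0. Qed.

Lemma le_emb r s : (emb F r <= emb F s) = (r <= s).
Proof. by case: F => //=; rewrite lecR. Qed.

Lemma lt_emb r s : (emb F r < emb F s) = (r < s).
Proof. by case: F => //=; rewrite ltcR. Qed.

Lemma ge0_embE (x : K) : 0 <= x -> emb F (real_part F x) = x.
Proof.
case: F x => //= -[a b]; rewrite lecE /= => /andP[/eqP -> _] //.
Qed.

Lemma emb_rnorm (V : normedZmodType K) (v : V) : emb F (rnorm F v) = `|v|.
Proof. exact: ge0_embE. Qed.

Lemma rnorm_ge0 (V : normedZmodType K) (v : V) : 0 <= rnorm F v.
Proof. by rewrite -le_emb emb_rnorm rmorph0. Qed.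

Lemma rnorm0 (V : normedZmodType K) : rnorm F (0 : V) = 0.
Proof. by rewrite /rnorm normr0 raddf0. Qed.

Lemma rnorm_eq0 (V : normedZmodType K) (v : V) : rnorm F v = 0 -> v = 0.
Proof. by move=> v0; apply/normr0_eq0; rewrite -emb_rnorm v0 rmorph0. Qed.

Lemma rnorm_neq0 (V : normedZmodType K) (v : V) : v != 0 -> rnorm F v != 0.
Proof. by apply: contra_neq => /rnorm_eq0. Qed.

Lemma rnormN (V : normedZmodType K) (v : V) : rnorm F (- v) = rnorm F v.
Proof. by rewrite /rnorm normrN. Qed.

Lemma rnormD (V : normedZmodType K) (u v : V) :
  rnorm F (u + v) <= rnorm F u + rnorm F v.
Proof. by rewrite -le_emb rmorphD /= !emb_rnorm ler_normD. Qed.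

Lemma rnorm_sum (V : normedZmodType K) I (s : seq I) (u : I -> V) :
  rnorm F (\sum_(i <- s) u i) <= \sum_(i <- s) rnorm F (u i).
Proof.
elim/big_rec2 : _ => [|i y x _ le_xy]; first by rewrite rnorm0.
by apply: le_trans (rnormD _ _) _; rewrite lerD2l.
Qed.

Lemma rnormZ (V : normedModType K) a (v : V) :
  rnorm F (a *: v) = rnorm F a * rnorm F v.
Proof.
by apply: (fmorph_inj (emb F)); rewrite rmorphM /= !emb_rnorm normrZ.
Qed.

Lemma rnormM (a b : K) : rnorm F (a * b) = rnorm F a * rnorm F b.
Proof.
by apply: (fmorph_inj (emb F)); rewrite rmorphM /= !emb_rnorm normrM.
Qed.

Lemma rnorm1 : rnorm F (1 : K) = 1.
Proof. by apply: (fmorph_inj (emb F)); rewrite /= emb_rnorm rmorph1 normr1. Qed.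

Lemma rnorm_emb r : rnorm F (emb F r) = `|r|.
Proof.
apply: (fmorph_inj (emb F)); rewrite /= emb_rnorm.
have [r0|r0] := leP 0 r.
  by rewrite !ger0_norm // -(rmorph0 (emb F)) le_emb.
by rewrite !ltr0_norm // ?rmorphN // -(rmorph0 (emb F)) lt_emb.
Qed.

Lemma real_part_le (x : K) : real_part F x <= rnorm F x.
Proof.
rewrite -le_emb emb_rnorm; case: F x => /= x; first exact: ler_norm.
by apply: le_trans (normc_ge_Re x); rewrite lecR ler_norm.
Qed.

(** This phase correction turns bounds on real parts into bounds on moduli. *)
Lemma rotate_to_norm (x : K) :
  exists2 c : K, rnorm F c = 1 & c * x = emb F (rnorm F x).
Proof.
have [->|x0] := eqVneq x 0.
  by exists 1; rewrite ?rnorm1 // mulr0 rnorm0 rmorph0.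
exists (emb F (rnorm F x) / x); last by rewrite divfK.
apply: (mulIf (rnorm_neq0 x0)).
by rewrite -rnormM divfK // rnorm_emb mul1r ger0_norm ?rnorm_ge0.
Qed.

Lemma emb_open_unit r : 0 < r < 1 -> 0 < emb F r < 1.
Proof. by rewrite -!lt_emb rmorph0 rmorph1. Qed.

Lemma open_unit_emb (t : K) : 0 < t < 1 -> exists2 r, 0 < r < 1 & t = emb F r.
Proof.
move=> /andP[t0 t1]; exists (real_part F t); last by rewrite ge0_embE ?ltW.
by rewrite -!lt_emb rmorph0 rmorph1 ge0_embE ?ltW // t0.
Qed.

End scalars.

(** * Linear maps *)

Section linear_maps.
Context {K : numFieldType} {V W : lmodType K} {f : V -> W}.
Hypothesis f_lin : linear f.

Lemma linear_mapD u v : f (u + v) = f u + f v.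
Proof. by rewrite -[in LHS](scale1r u) f_lin scale1r. Qed.

Lemma linear_map0 : f 0 = 0.
Proof. by apply: (addIr (f 0)); rewrite -linear_mapD !add0r. Qed.

Lemma linear_mapZ a v : f (a *: v) = a *: f v.
Proof. by rewrite -[in LHS](addr0 (a *: v)) f_lin linear_map0 addr0. Qed.

Lemma linear_mapB u v : f (u - v) = f u - f v.
Proof. by rewrite linear_mapD -scaleN1r linear_mapZ scaleN1r. Qed.

Lemma linear_map_sum I (s : seq I) (u : I -> V) :
  f (\sum_(i <- s) u i) = \sum_(i <- s) f (u i).
Proof.
by elim/big_rec2 : _ => [|i y x _ <-]; rewrite (linear_map0, linear_mapD).
Qed.

End linear_maps.

(** * The Hahn-Banach theorem *)

Section hahn_banach.
Context {R : realType} {K : numFieldType} {F : real_or_complex R K}.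
Implicit Types V D : lmodType K.

Definition sublinear V (q : V -> R) : Prop :=
  (forall u v, q (u + v) <= q u + q v) /\
  (forall (r : R) v, 0 <= r -> q (emb F r *: v) = r * q v).

Definition real_linear V (g : V -> R) : Prop :=
  (forall u v, g (u + v) = g u + g v) /\
  (forall r v, g (emb F r *: v) = r * g v).

Definition seminorm V (N : V -> R) : Prop :=
  (forall u v, N (u + v) <= N u + N v) /\
  (forall a v, N (a *: v) = rnorm F a * N v).

Lemma seminorm_sublinear V (N : V -> R) : seminorm N -> sublinear N.
Proof. by case=> ND NZ; split=> // r v r0; rewrite NZ rnorm_emb ger0_norm. Qed.

Lemma seminorm0 V (N : V -> R) : seminorm N -> N 0 = 0.
Proof. by case=> _ NZ; rewrite -(scale0r 0) NZ rnorm0 mul0r. Qed.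

Lemma seminormN V (N : V -> R) v : seminorm N -> N (- v) = N v.
Proof. by case=> _ NZ; rewrite -scaleN1r NZ rnormN rnorm1 mul1r. Qed.

Lemma seminorm_ge0 V (N : V -> R) v : seminorm N -> 0 <= N v.
Proof.
move=> sN; have := sN.1 v (- v).
by rewrite subrr (seminorm0 sN) (seminormN _ sN); lra.
Qed.

Lemma sublinear0 V (q : V -> R) : sublinear q -> q 0 = 0.
Proof. by case=> _ /(_ 0 0 (lexx _)); rewrite scaler0 mul0r. Qed.

Lemma sublinear_ge_opp V (q : V -> R) v : sublinear q -> - q (- v) <= q v.
Proof.
by move=> sq; have := sq.1 v (- v); rewrite subrr sublinear0 //; lra.
Qed.

(** Homogeneity only has to be checked as an inequality, because it can be
    applied to the inverse factor. *)
Lemma sublinear_intro V (q : V -> R) :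
  (forall u v, q (u + v) <= q u + q v) -> q 0 = 0 ->
  (forall (r : R) v, 0 < r -> q (emb F r *: v) <= r * q v) -> sublinear q.
Proof.
move=> qD q0 qZ; split=> // r v; rewrite le_eqVlt => /predU1P[<-|r0].
  by rewrite rmorph0 scale0r mul0r.
apply/eqP; rewrite eq_le qZ //=.
have ri : 0 < r^-1 by rewrite invr_gt0.
rewrite -ler_pdivlMl //; apply: le_trans (qZ _ _ ri).
by rewrite scalerA -rmorphM mulVf ?gt_eqF // rmorph1 scale1r.
Qed.

(** Lowering a sublinear functional [q] along a convex cone [C] of pairs
    (direction, value) with value at most [q]: the result is at most minus the
    value on minus the direction. Both the extension of a functional from a
    subspace and the linearity of minimal sublinear functionals use it. *)
Definition lower_along V (C : set (V * R)) (q : V -> R) (v : V) : R :=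
  inf [set q (v + c.1) - c.2 | c in C].

Section lower_along.
Variables (V : lmodType K) (C : set (V * R)) (q : V -> R).
Hypothesis q_sub : sublinear q.
Hypothesis C0 : C (0, 0).
Hypothesis CD : forall a b, C a -> C b -> C (a.1 + b.1, a.2 + b.2).
Hypothesis CZ : forall (r : R) a, 0 < r -> C a -> C (emb F r *: a.1, r * a.2).
Hypothesis C_le : forall a, C a -> a.2 <= q a.1.

Lemma lower_along_bounded v :
  lbound [set q (v + c.1) - c.2 | c in C] (- q (- v)).
Proof.
move=> _ [c Cc <-]; have := C_le Cc; have := q_sub.1 (v + c.1) (- v).
by rewrite addrAC subrr add0r; lra.
Qed.

Lemma lower_along_le v c : C c -> lower_along C q v <= q (v + c.1) - c.2.
Proof.
move=> Cc; apply: ge_inf; last by exists c.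
by exists (- q (- v)); exact: lower_along_bounded.
Qed.

Lemma lower_along_ge v x :
  (forall c, C c -> x <= q (v + c.1) - c.2) -> x <= lower_along C q v.
Proof.
move=> xle; apply: lb_le_inf; first by exists (q (v + 0) - 0), (0, 0).
by move=> _ [c Cc <-]; exact: xle.
Qed.

Lemma lower_along_le_self v : lower_along C q v <= q v.
Proof. by have := lower_along_le v C0; rewrite /= addr0 subr0. Qed.

Lemma lower_along_opp c : C c -> lower_along C q (- c.1) <= - c.2.
Proof.
by move=> /(lower_along_le (- c.1)); rewrite addNr (sublinear0 q_sub) sub0r.
Qed.

Lemma lower_along_sublinear : sublinear (lower_along C q).
Proof.
apply: sublinear_intro => [u v| |r v r0].
- suff uv a : C a ->
      lower_along C q (u + v) - (q (u + a.1) - a.2) <= lower_along C q v.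
    rewrite -lerBlDr; apply: lower_along_ge => a Ca; have := uv a Ca; lra.
  move=> Ca; apply: lower_along_ge => b Cb.
  have := lower_along_le (u + v) (CD Ca Cb).
  have /= := q_sub.1 (u + a.1) (v + b.1).
  by rewrite addrACA; lra.
- apply/eqP; rewrite eq_le; apply/andP; split.
    by have := lower_along_le_self 0; rewrite (sublinear0 q_sub).
  by apply: lower_along_ge => c Cc; rewrite add0r subr_ge0; exact: C_le.
- rewrite -ler_pdivrMl //; apply: lower_along_ge => c Cc.
  rewrite ler_pdivrMl //; apply: le_trans (lower_along_le _ (CZ r0 Cc)) _.
  by rewrite /= -scalerDr (q_sub.2 _ _ (ltW r0)) mulrBr.
Qed.

End lower_along.

(** A minimal sublinear functional [q] is linear: lowering it along the ray
    through [(v, q v)] cannot change it, which forces [q (u + v)] to be at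
    least [q u + q v]. *)
Lemma minimal_sublinear_linear V (q : V -> R) : sublinear q ->
  (forall q', sublinear q' -> (forall v, q' v <= q v) -> q' = q) ->
  real_linear q.
Proof.
move=> q_sub q_min.
have qD u v : q (u + v) = q u + q v.
  apply/eqP; rewrite eq_le q_sub.1 /=.
  pose C : set (V * R) :=
    [set c | exists2 t, 0 <= t & c = (emb F t *: v, t * q v)].
  have C0 : C (0, 0) by exists 0; rewrite ?rmorph0 ?scale0r ?mul0r.
  have CD a b : C a -> C b -> C (a.1 + b.1, a.2 + b.2).
    move=> [s s0 ->] [t t0 ->]; exists (s + t); first by rewrite addr_ge0.
    by rewrite rmorphD /= scalerDl mulrDl.
  have CZ (r : R) a : 0 < r -> C a -> C (emb F r *: a.1, r * a.2).
    move=> r0 [t t0 ->]; exists (r * t); first by rewrite mulr_ge0 // ltW.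
    by rewrite rmorphM /= scalerA mulrA.
  have C_le a : C a -> a.2 <= q a.1 by move=> [t t0 ->] /=; rewrite q_sub.2.
  have lowC := q_min _ (lower_along_sublinear q_sub C0 CD CZ C_le)
    (lower_along_le_self q_sub C0 C_le).
  have Cv : C (v, q v) by exists 1; rewrite ?rmorph1 ?scale1r ?mul1r.
  by have := lower_along_le q_sub C_le u Cv; rewrite lowC /=; lra.
have qN v : q (- v) = - q v.
  by have := qD v (- v); rewrite subrr (sublinear0 q_sub); lra.
split=> // r v; have [r0|r0] := leP 0 r; first exact: q_sub.2.
rewrite -[in LHS](opprK r) rmorphN scaleNr qN q_sub.2 ?oppr_ge0 ?ltW //.
by rewrite mulNr opprK.
Qed.

(** Zorn's lemma provides a minimal sublinear functional below [p]: the values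
    at [v] of a chain are bounded below by [- p (- v)], so that its pointwise
    infimum is finite. *)
Lemma linear_below_sublinear V (p : V -> R) : sublinear p ->
  exists2 g, real_linear g & forall v, g v <= p v.
Proof.
move=> p_sub; pose T := {q : V -> R | sublinear q /\ forall v, q v <= p v}.
pose below (s t : T) := `[< forall v, sval t v <= sval s v >].
have [||||q q_max] := @Zorn T below.
- by move=> t; apply/asboolP.
- move=> r s t /asboolP rs /asboolP st; apply/asboolP => v.
  exact: le_trans (st v) (rs v).
- move=> [q Pq] [q' Pq'] /asboolP qq' /asboolP q'q; apply: eq_exist.
  by apply/funext => v; apply/eqP; rewrite eq_le qq' q'q.
- move=> A A_tot; have [[s0 As0]|A0] := pselect (A !=set0); last first.
    have pp : sublinear p /\ forall v, p v <= p v by split.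
    by exists (exist _ p pp) => s As; case: A0; exists s.
  pose m v := inf [set sval s v | s in A].
  have m_bounded v : has_lbound [set sval s v | s in A].
    exists (- p (- v)) => _ [[q [q_sub qp]] _ <-] /=.
    by apply: le_trans (sublinear_ge_opp v q_sub); rewrite lerN2.
  have m_le s v : A s -> m v <= sval s v.
    by move=> As; apply: ge_inf => //; exists s.
  have m_ge v x : (forall s, A s -> x <= sval s v) -> x <= m v.
    move=> xle; apply: lb_le_inf; first by exists (sval s0 v), s0.
    by move=> _ [s As <-]; exact: xle.
  have m_sub : sublinear m.
    apply: sublinear_intro => [u v| |r v r_gt0].
    + suff uv s : A s -> m (u + v) - sval s u <= m v.
        by rewrite -lerBlDr; apply: m_ge => s As; have := uv s As; lra.
      move=> As; apply: m_ge => t At; rewrite lerBlDl.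
      have [/asboolP st|/asboolP ts] := A_tot _ _ As At.
        apply: le_trans (m_le _ _ At) _; apply: le_trans ((svalP t).1.1 u v) _.
        by rewrite lerD2r.
      apply: le_trans (m_le _ _ As) _; apply: le_trans ((svalP s).1.1 u v) _.
      by rewrite lerD2l.
    + apply/eqP; rewrite eq_le; apply/andP; split.
        by have := m_le _ 0 As0; rewrite (sublinear0 (svalP s0).1).
      by apply: m_ge => s _; rewrite (sublinear0 (svalP s).1).
    + rewrite -ler_pdivrMl //; apply: m_ge => s As; rewrite ler_pdivrMl //.
      by rewrite -((svalP s).1.2 _ _ (ltW r_gt0)) m_le.
  have mp : sublinear m /\ forall v, m v <= p v.
    by split=> // v; exact: le_trans (m_le _ v As0) ((svalP s0).2 v).
  by exists (exist _ m mp) => s As; apply/asboolP => v; exact: m_le.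
exists (sval q); last exact: (svalP q).2.
apply: minimal_sublinear_linear (svalP q).1 _ => q' q'_sub q'q.
have q'P : sublinear q' /\ forall v, q' v <= p v.
  by split=> // v; exact: le_trans (q'q v) ((svalP q).2 v).
by have /(congr1 sval) := q_max (exist _ q' q'P) (introT (asboolP _) q'q).
Qed.

(** The subspace carrying the functional to extend is given as the image of a
    linear map [j]: it is the diagonal of a square in one use and a line in
    another. *)
Lemma real_hahn_banach V D (p : V -> R) (j : D -> V) (f : D -> R) :
  sublinear p -> linear j -> real_linear f -> (forall d, f d <= p (j d)) ->
  exists g, [/\ real_linear g, forall v, g v <= p v & forall d, g (j d) = f d].
Proof.
move=> p_sub j_lin f_lin fp.
have f0 : f 0 = 0 by rewrite -(scale0r 0) -(rmorph0 (emb F)) f_lin.2 mul0r.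
pose C : set (V * R) := [set c | exists d, c = (j d, f d)].
have C0 : C (0, 0) by exists 0; rewrite (linear_map0 j_lin) f0.
have CD a b : C a -> C b -> C (a.1 + b.1, a.2 + b.2).
  by move=> [d ->] [e ->]; exists (d + e); rewrite (linear_mapD j_lin) f_lin.1.
have CZ (r : R) a : 0 < r -> C a -> C (emb F r *: a.1, r * a.2).
  move=> _ [d ->]; exists (emb F r *: d).
  by rewrite (linear_mapZ j_lin) f_lin.2.
have C_le a : C a -> a.2 <= p a.1 by move=> [d ->]; exact: fp.
have [g g_lin gp] :=
  linear_below_sublinear (lower_along_sublinear p_sub C0 CD CZ C_le).
have gN v : g (- v) = - g v.
  by rewrite -scaleN1r -(rmorph1 (emb F)) -rmorphN g_lin.2 mulN1r.
have gf d : f d <= g (j d).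
  have Cd : C (j d, f d) by exists d.
  have := le_trans (gp _) (lower_along_opp p_sub C_le Cd).
  by rewrite /= gN; lra.
exists g; split=> // [v|d].
  exact: le_trans (gp v) (lower_along_le_self p_sub C0 C_le v).
apply/eqP; rewrite eq_le gf andbT.
have := gf (- d); have -> : f (- d) = - f d.
  by rewrite -scaleN1r -(rmorph1 (emb F)) -rmorphN f_lin.2 mulN1r.
by rewrite -scaleN1r (linear_mapZ j_lin) scaleN1r gN; lra.
Qed.

End hahn_banach.

Arguments sublinear {R K} F {V}.
Arguments real_linear {R K} F {V}.
Arguments seminorm {R K} F {V}.

(** Over the complex numbers the functional is [g v - i g (i v)]. *)
Lemma linear_of_real_part (R : realType) (K : numFieldType)
    (F : real_or_complex R K) (V : lmodType K) (g : V -> R) :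
  real_linear F g ->
  exists2 f : V -> K^o, linear f & forall v, real_part F (f v) = g v.
Proof.
case: F V g => V g [gD gZ].
  by exists g => // a u v; rewrite gD gZ.
exists (fun v => (g v -i* g ('i *: v))%C) => // a u v.
have aE : a = (emb (ComplexScalars R) (complex.Re a) +
  emb (ComplexScalars R) (complex.Im a) * 'i)%C.
  by rewrite /= mulrC; exact: complexE.
have aiE : ('i * a = emb (ComplexScalars R) (complex.Re a) * 'i +
  emb (ComplexScalars R) (- complex.Im a))%C.
  by rewrite {1}(complexE a) /= mulrDr mulrA -expr2 sqr_i rmorphN mulN1r mulrC.
rewrite scalerDr scalerA aiE {1}aE !scalerDl -!scalerA !gD !gZ.
case: a {aE aiE} => x y /=; apply/eqP; rewrite eq_complex /=.
by apply/andP; split; apply/eqP; ring.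
Qed.

Section linear_functionals.
Context {R : realType} {K : numFieldType} {F : real_or_complex R K}.
Implicit Types V D : lmodType K.

Lemma functionalZ V (f : V -> K^o) a v : linear f -> f (a *: v) = a * f v.
Proof. by move=> f_lin; rewrite (linear_mapZ f_lin). Qed.

Lemma real_linear_real_part V (f : V -> K^o) :
  linear f -> real_linear F (fun v => real_part F (f v)).
Proof.
move=> f_lin; split=> [u v|r v]; first by rewrite (linear_mapD f_lin) raddfD.
by rewrite functionalZ // real_part_embM.
Qed.

(** The real theorem extends the real part of [f]. Equality of real parts on
    all multiples of a vector gives equality, and a bound on the real part
    gives the bound on the modulus, both by rotating the value. *)
Lemma hahn_banach V D (N : V -> R) (j : D -> V) (f : D -> K^o) :
  seminorm F N -> linear j -> linear f ->
  (forall d, rnorm F (f d) <= N (j d)) ->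
  exists g : V -> K^o,
    [/\ linear g, forall v, rnorm F (g v) <= N v & forall d, g (j d) = f d].
Proof.
move=> N_sem j_lin f_lin fN.
have [|h [h_lin hN hf]] := real_hahn_banach (seminorm_sublinear N_sem) j_lin
    (real_linear_real_part f_lin).
  by move=> d; exact: le_trans (real_part_le _) (fN d).
have [g g_lin gh] := linear_of_real_part h_lin.
exists g; split=> // [v|d].
  have [c c1 cg] := rotate_to_norm (F := F) (g v).
  rewrite -[leLHS](real_part_emb (F := F)) -cg -functionalZ // gh.
  by apply: le_trans (hN _) _; rewrite N_sem.2 c1 mul1r.
have [c c1 cg] := rotate_to_norm (F := F) (g (j d) - f d).
apply/eqP; rewrite -subr_eq0; apply/eqP/(rnorm_eq0 (F := F)).
rewrite -[LHS](real_part_emb (F := F)) -cg mulrBr raddfB /= -!functionalZ //.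
by rewrite gh -(linear_mapZ j_lin) hf subrr.
Qed.

Lemma norm_seminorm (X : normedModType K) : seminorm F (fun v : X => rnorm F v).
Proof. by split=> [u v|a v]; [exact: rnormD|exact: rnormZ]. Qed.

Lemma norming_functional (X : normedModType K) (x : X) :
  exists g : X -> K^o, [/\ linear g, forall v, rnorm F (g v) <= rnorm F v
    & g x = emb F (rnorm F x)].
Proof.
have [|||g [g_lin gN gx]] := @hahn_banach X K^o _ (fun a : K^o => a *: x)
  (fun a : K^o => a * emb F (rnorm F x) : K^o) (@norm_seminorm X).
- by move=> a b c /=; rewrite scalerDl scalerA.
- by move=> a b c /=; rewrite mulrDl [in RHS]scalerAl.
- move=> a; rewrite !rnormZ ler_wpM2l ?rnorm_ge0 //.
  have := lexx `|rnorm F x|; rewrite -{1}(rnorm_emb (F := F)) ger0_norm //.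
  exact: rnorm_ge0.
by exists g; split=> //; rewrite -[in LHS](scale1r x) gx mul1r.
Qed.

End linear_functionals.

(** * The finite-dimensional spaces of p-summable scalar tuples *)

Section lp_norms.
Context {R : realType} {K : numFieldType} {F : real_or_complex R K}.
Context {d : nat}.
Implicit Types (a b : 'I_d -> K) (p q : R).

Definition conjugate_exponents p q : Prop :=
  [/\ 0 < p, 0 < q & p^-1 + q^-1 = 1].

Lemma conjugate_exponents_sym p q :
  conjugate_exponents p q -> conjugate_exponents q p.
Proof. by case=> p0 q0 pq; split; rewrite // addrC. Qed.

Lemma lp_norm_ge0 p a : 0 <= lp_norm F p a.
Proof. exact: powR_ge0. Qed.

Lemma lp_norm_powR p a : 0 < p ->
  lp_norm F p a `^ p = \sum_(i < d) rnorm F (a i) `^ p.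
Proof.
move=> p0; rewrite -powRrM mulVf ?gt_eqF // powRr1 // sumr_ge0 // => i _.
exact: powR_ge0.
Qed.

Lemma lp_norm_eq0 p a i : 0 < p -> lp_norm F p a = 0 -> a i = 0.
Proof.
move=> p0 a0; have := lp_norm_powR a p0; rewrite a0 powR0 ?gt_eqF //.
move/esym/eqP; rewrite psumr_eq0 => [|j _]; last exact: powR_ge0.
move/allP/(_ i (mem_index_enum i)); rewrite powR_eq0 => /andP[/eqP + _].
exact: rnorm_eq0.
Qed.

Lemma lp_norm1 p a : 0 < p -> \sum_(i < d) rnorm F (a i) `^ p = 1 ->
  lp_norm F p a = 1.
Proof. by move=> p0; rewrite /lp_norm => ->; rewrite powR1. Qed.

Lemma lp_normZ p (c : K) a : 0 < p ->
  lp_norm F p (fun i => c * a i) = rnorm F c * lp_norm F p a.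
Proof.
move=> p0; rewrite /lp_norm.
under eq_bigr do rewrite rnormM powRM ?rnorm_ge0 //.
rewrite -mulr_sumr powRM ?powR_ge0 ?sumr_ge0 // => [|i _]; last exact: powR_ge0.
by rewrite -powRrM mulfV ?gt_eqF // powRr1 ?rnorm_ge0.
Qed.

Lemma lp_norm_delta p (j : 'I_d) : 0 < p ->
  lp_norm F p (fun i => (i == j)%:R) = 1.
Proof.
move=> p0; apply: lp_norm1 => //; rewrite (bigD1 j) //= eqxx rnorm1 powR1.
rewrite big1 ?addr0 // => i /negPf ->.
by rewrite (rnorm0 (F := F) K) powR0 ?gt_eqF.
Qed.

(** Both tuples are normalised so that each product is bounded by Young's
    inequality. *)
Lemma real_hoelder p q (x y : 'I_d -> R) (A B : R) :
  conjugate_exponents p q -> 0 < A -> 0 < B ->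
  (forall i, 0 <= x i) -> (forall i, 0 <= y i) ->
  \sum_(i < d) x i `^ q = A `^ q -> \sum_(i < d) y i `^ p = B `^ p ->
  \sum_(i < d) x i * y i <= A * B.
Proof.
move=> [p0 q0 pq] A0 B0 x0 y0 xA yB.
have normalized r (z : 'I_d -> R) (C : R) : 0 < C -> (forall i, 0 <= z i) ->
    \sum_(i < d) z i `^ r = C `^ r -> \sum_(i < d) (z i / C) `^ r = 1.
  move=> C0 z0 zC; have Ci : 0 <= C^-1 by rewrite invr_ge0 ltW.
  under eq_bigr do rewrite powRM //.
  by rewrite -mulr_suml zC -(powRM _ (ltW C0) Ci) mulfV ?gt_eqF // powR1.
have AB0 := mulr_gt0 A0 B0.
rewrite -[leRHS]mul1r -(ler_pdivrMr _ _ AB0) mulr_suml.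
apply: le_trans (_ : \sum_(i < d)
  ((y i / B) `^ p / p + (x i / A) `^ q / q) <= _).
  apply: ler_sum => i _.
  have -> : x i * y i / (A * B) = (y i / B) * (x i / A).
    by field; rewrite !gt_eqF.
  by apply: conjugate_powR; rewrite ?divr_ge0 // ltW.
by rewrite big_split /= -!mulr_suml !normalized // !mul1r pq.
Qed.

Lemma hoelder_lp_norm p q a b : conjugate_exponents p q ->
  rnorm F (\sum_(i < d) a i * b i) <= lp_norm F q a * lp_norm F p b.
Proof.
move=> pq; have [p0 q0 _] := pq.
have [a0|a_neq0] := eqVneq (lp_norm F q a) 0.
  rewrite a0 mul0r big1 ?rnorm0 // => i _.
  by rewrite (lp_norm_eq0 i q0 a0) mul0r.
have [b0|b_neq0] := eqVneq (lp_norm F p b) 0.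
  rewrite b0 mulr0 big1 ?rnorm0 // => i _.
  by rewrite (lp_norm_eq0 i p0 b0) mulr0.
apply: le_trans (rnorm_sum _ _) _; under eq_bigr do rewrite rnormM.
apply: (real_hoelder pq).
- by rewrite lt_def a_neq0 lp_norm_ge0.
- by rewrite lt_def b_neq0 lp_norm_ge0.
- by move=> i; exact: rnorm_ge0.
- by move=> i; exact: rnorm_ge0.
- by rewrite lp_norm_powR.
- by rewrite lp_norm_powR.
Qed.

(** The case of equality in the previous inequality; the extremal tuple has
    entries of modulus [|b i|^(p-1)], with the phases opposite to those of
    [b]. *)
Lemma hoelder_extremal p q b : (0 < d)%N -> conjugate_exponents p q ->
  exists2 a, lp_norm F q a = 1 & \sum_(i < d) a i * b i = emb F (lp_norm F p b).
Proof.
move=> d_gt0 [p0 q0 pq].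
have [b0|b_neq0] := eqVneq (lp_norm F p b) 0.
  exists (fun i => (i == Ordinal d_gt0)%:R); first exact: lp_norm_delta.
  rewrite b0 rmorph0 big1 // => i _.
  by rewrite (lp_norm_eq0 i p0 b0) mulr0.
have [B [B0 BE bB]] : exists B, [/\ 0 < B, lp_norm F p b = B &
    \sum_(i < d) rnorm F (b i) `^ p = B `^ p].
  exists (lp_norm F p b); split=> //; last by rewrite lp_norm_powR.
  by rewrite lt_def b_neq0 lp_norm_ge0.
have Bi : 0 <= B^-1 by rewrite invr_ge0 ltW.
have b_unit : \sum_(i < d) (rnorm F (b i) / B) `^ p = 1.
  under eq_bigr do rewrite powRM ?rnorm_ge0 //.
  by rewrite -mulr_suml bB -(powRM _ (ltW B0) Bi) mulfV ?gt_eqF // powR1.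
rewrite BE {BE bB b_neq0}.
have phase i : exists c : K, rnorm F c = 1 /\ c * b i = emb F (rnorm F (b i)).
  by have [c c1 cb] := rotate_to_norm (F := F) (b i); exists c.
have [c cP] := choice phase.
exists (fun i => c i * emb F ((rnorm F (b i) / B) `^ (p - 1))).
  apply: lp_norm1 => //; rewrite -[RHS]b_unit; apply: eq_bigr => i _.
  rewrite rnormM (cP i).1 mul1r rnorm_emb ger0_norm ?powR_ge0 // -powRrM.
  congr (_ `^ _); have : (p^-1 + q^-1) * (p * q) = p * q by rewrite pq mul1r.
  rewrite mulrDl mulrA mulVf ?gt_eqF // mul1r mulrCA mulVf ?gt_eqF // mulr1.
  lra.
transitivity (emb F (B * \sum_(i < d) (rnorm F (b i) / B) `^ p)); last first.
  by rewrite b_unit mulr1.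
rewrite mulr_sumr rmorph_sum; apply: eq_bigr => i _ /=.
rewrite mulrAC (cP i).2 -rmorphM /= -(mulr_powRB1 _ p0) ?mulr_ge0 ?rnorm_ge0 //.
by rewrite mulrA [B * _]mulrC divfK // gt_eqF.
Qed.

Lemma lp_normD p q a b : (0 < d)%N -> conjugate_exponents p q ->
  lp_norm F p (fun i => a i + b i) <= lp_norm F p a + lp_norm F p b.
Proof.
move=> d_gt0 pq.
have [c c1 cab] := hoelder_extremal (fun i => a i + b i) d_gt0 pq.
rewrite -[leLHS]ger0_norm ?lp_norm_ge0 // -(rnorm_emb (F := F)) -cab.
under eq_bigr do rewrite mulrDr.
rewrite big_split; apply: le_trans (rnormD _ _) _.
by apply: lerD; apply: le_trans (hoelder_lp_norm _ _ pq) _; rewrite c1 mul1r.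
Qed.

Lemma coord_le_lp_norm p q a i : conjugate_exponents p q ->
  rnorm F (a i) <= lp_norm F p a.
Proof.
move=> pq; have := hoelder_lp_norm (fun j => (j == i)%:R) a pq.
rewrite lp_norm_delta ?mul1r; last by case: pq.
rewrite (bigD1 i) //= eqxx mul1r big1 ?addr0 // => j /negPf ->.
by rewrite mul0r.
Qed.

Lemma lp_norm_le_sum p q a : (0 < d)%N -> conjugate_exponents p q ->
  lp_norm F p a <= \sum_(i < d) rnorm F (a i).
Proof.
move=> d_gt0 pq; have [c c1 ca] := hoelder_extremal a d_gt0 pq.
rewrite -[leLHS]ger0_norm ?lp_norm_ge0 // -(rnorm_emb (F := F)) -ca.
apply: le_trans (rnorm_sum _ _) _; apply: ler_sum => i _.
rewrite rnormM ler_piMl ?rnorm_ge0 // -c1.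
exact: coord_le_lp_norm (conjugate_exponents_sym pq).
Qed.

End lp_norms.

(** * Extreme functionals below a supremum of seminorms *)

Section dual_balls.
Context {R : realType} {K : numFieldType} {F : real_or_complex R K}.
Implicit Types V : lmodType K.

Lemma bound_of_unit_ball V (N : V -> R) (f : V -> K^o) (c : R) :
  seminorm F N -> linear f -> (forall v, N v = 0 -> f v = 0) ->
  (forall v, N v <= 1 -> rnorm F (f v) <= c) ->
  forall v, rnorm F (f v) <= c * N v.
Proof.
move=> N_sem f_lin f0 fc v; have [v0|v_neq0] := eqVneq (N v) 0.
  by rewrite f0 // rnorm0 v0 mulr0.
have v_gt0 : 0 < N v by rewrite lt_def v_neq0 (seminorm_ge0 _ N_sem).
have Nvi : `|(N v)^-1| = (N v)^-1 by rewrite ger0_norm // invr_ge0 ltW.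
have := fc (emb F (N v)^-1 *: v); rewrite N_sem.2 rnorm_emb Nvi mulVf //.
move=> /(_ (lexx 1)); rewrite functionalZ // rnormM rnorm_emb Nvi.
by rewrite ler_pdivrMl // mulrC.
Qed.

Lemma dual_ballP V (N : V -> R) (f : V -> K^o) : seminorm F N ->
  dual_ball F N f <-> linear f /\ forall v, rnorm F (f v) <= N v.
Proof.
move=> N_sem; split=> [[[f_lin [C fC]] f1]|[f_lin fN]].
  split=> // v; rewrite -[leRHS]mul1r.
  apply: bound_of_unit_ball => // {}v Nv.
    by apply: (rnorm_eq0 (F := F)); apply/eqP; rewrite eq_le rnorm_ge0 andbT;
      have := fC v; rewrite Nv mulr0.
  apply: le_trans f1; apply: ub_le_sup; last by exists v.
  exists `|C| => _ [w Nw <-]; apply: le_trans (fC w) _.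
  apply: le_trans (_ : `|C| * N w <= _).
    by rewrite ler_wpM2r ?ler_norm ?(seminorm_ge0 _ N_sem).
  by rewrite ler_piMr.
split; first by split=> //; exists 1 => v; rewrite mul1r.
apply: ge_sup.
  by exists (rnorm F (f 0)), 0 => //=; rewrite (seminorm0 N_sem).
by move=> _ [v Nv <-]; exact: le_trans (fN v) Nv.
Qed.

(** Extend [f] from the diagonal of [V * V] to a functional bounded by the
    maximum of the two seminorms of the components. Its restrictions to the two
    factors have norms [c] and at most [1 - c], because two vectors of the
    factors can be rotated so that the absolute values add up. *)
Lemma dominated_by_max_split V (N1 N2 : V -> R) (f : V -> K^o) :
  seminorm F N1 -> seminorm F N2 -> linear f ->
  (forall v, rnorm F (f v) <= Num.max (N1 v) (N2 v)) ->
  exists c (f1 f2 : V -> K^o), [/\ 0 <= c <= 1,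
    linear f1 /\ (forall v, rnorm F (f1 v) <= c * N1 v),
    linear f2 /\ (forall v, rnorm F (f2 v) <= (1 - c) * N2 v)
    & forall v, f v = f1 v + f2 v].
Proof.
move=> N1_sem N2_sem f_lin fN.
pose N (w : V * V) := Num.max (N1 w.1) (N2 w.2).
have N_sem : seminorm F N.
  split=> [u v|a v]; last by rewrite /N N1_sem.2 N2_sem.2 maxr_pMr ?rnorm_ge0.
  rewrite /N ge_max; apply/andP; split.
    by apply: le_trans (N1_sem.1 _ _) _; apply: lerD; rewrite le_max lexx.
  by apply: le_trans (N2_sem.1 _ _) _; apply: lerD; rewrite le_max lexx orbT.
have [//|g [g_lin gN gf]] :=
  hahn_banach (j := fun v => (v, v) : V * V) N_sem _ f_lin fN.
have g1_lin : linear (fun v => g (v, 0)).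
  move=> a u v; rewrite -g_lin; congr g.
  by rewrite [RHS]surjective_pairing /= scaler0 addr0.
have g2_lin : linear (fun v => g (0, v)).
  move=> a u v; rewrite -g_lin; congr g.
  by rewrite [RHS]surjective_pairing /= scaler0 addr0.
have g1N v : rnorm F (g (v, 0)) <= N1 v.
  have := gN (v, 0); rewrite /N /= (seminorm0 N2_sem) max_l //.
  exact: seminorm_ge0 N1_sem.
have g2N v : rnorm F (g (0, v)) <= N2 v.
  have := gN (0, v); rewrite /N /= (seminorm0 N1_sem) max_r //.
  exact: seminorm_ge0 N2_sem.
pose c := dual_norm F N1 (fun v => g (v, 0)).
have g1c v : N1 v <= 1 -> rnorm F (g (v, 0)) <= c.
  move=> v1; apply: ub_le_sup; last by exists v.
  by exists 1 => _ [w w1 <-]; exact: le_trans (g1N w) w1.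
have c0 : 0 <= c.
  by apply: le_trans (g1c 0 _); rewrite ?rnorm_ge0 ?(seminorm0 N1_sem).
have g12 u v : N1 u <= 1 -> N2 v <= 1 ->
    rnorm F (g (u, 0)) + rnorm F (g (0, v)) <= 1.
  move=> u1 v1.
  have [a a1 au] := rotate_to_norm (F := F) (g (u, 0)).
  have [b b1 bv] := rotate_to_norm (F := F) (g (0, v)).
  have := gN (a *: u, b *: v).
  have -> : (a *: u, b *: v) = a *: (u, 0) + b *: (0, v) :> V * V.
    by rewrite [RHS]surjective_pairing /= !scaler0 addr0 add0r.
  rewrite (linear_mapD g_lin) (functionalZ a _ g_lin) (functionalZ b _ g_lin).
  rewrite au bv -rmorphD /= (rnorm_emb (F := F)).
  rewrite ger0_norm ?addr_ge0 ?rnorm_ge0 // => /le_trans; apply.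
  rewrite /N /= !scaler0 addr0 add0r N1_sem.2 N2_sem.2 a1 b1 !mul1r.
  by rewrite ge_max u1.
have g2c v : N2 v <= 1 -> rnorm F (g (0, v)) <= 1 - c.
  move=> v1; rewrite lerBrDr addrC -lerBrDr; apply: ge_sup.
    by exists (rnorm F (g (0, 0))), 0 => //=; rewrite (seminorm0 N1_sem).
  by move=> _ [u u1 <-]; rewrite lerBrDr g12.
exists c, (fun v => g (v, 0)), (fun v => g (0, v)); split.
- rewrite c0 -subr_ge0; apply: le_trans (g2c 0 _).
    exact: rnorm_ge0.
  by rewrite (seminorm0 N2_sem).
- split=> //; apply: bound_of_unit_ball => // v v0.
  by apply: (rnorm_eq0 (F := F)); apply/eqP; rewrite eq_le rnorm_ge0 -v0 g1N.
- split=> //; apply: bound_of_unit_ball => // v v0.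
  by apply: (rnorm_eq0 (F := F)); apply/eqP; rewrite eq_le rnorm_ge0 -v0 g2N.
- move=> v; rewrite -gf -(linear_mapD g_lin); congr g.
  by rewrite [RHS]surjective_pairing /= addr0 add0r.
Qed.

Lemma extreme_dominated_by_max V (N N1 N2 : V -> R) (f : V -> K^o) :
  seminorm F N -> seminorm F N1 -> seminorm F N2 ->
  (forall v, N1 v <= N v) -> (forall v, N2 v <= N v) ->
  extreme_points (dual_ball F N) f ->
  (forall v, rnorm F (f v) <= Num.max (N1 v) (N2 v)) ->
  (forall v, rnorm F (f v) <= N1 v) \/ (forall v, rnorm F (f v) <= N2 v).
Proof.
move=> N_sem N1_sem N2_sem N1N N2N [/(dual_ballP _ N_sem)[f_lin _] f_ext] fN.
have [c [f1 [f2 [/andP[c0 c1] [f1_lin f1N] [f2_lin f2N] fE]]]] :=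
  dominated_by_max_split N1_sem N2_sem f_lin fN.
have [cE|c_neq0] := eqVneq c 0.
  right=> v; have f1v : f1 v = 0.
    apply: (rnorm_eq0 (F := F)); apply/eqP; rewrite eq_le rnorm_ge0 andbT.
    by have := f1N v; rewrite cE mul0r.
  by have := f2N v; rewrite cE subr0 mul1r fE f1v add0r.
have [cE|c_neq1] := eqVneq c 1.
  left=> v; have f2v : f2 v = 0.
    apply: (rnorm_eq0 (F := F)); apply/eqP; rewrite eq_le rnorm_ge0 andbT.
    by have := f2N v; rewrite cE subrr mul0r.
  by have := f1N v; rewrite cE mul1r fE f2v addr0.
have c_gt0 : 0 < c by rewrite lt_def c_neq0.
have c_lt1 : 0 < 1 - c by rewrite subr_gt0 lt_def eq_sym c_neq1.
have scaled r (h : V -> K^o) (M : V -> R) : 0 < r -> linear h ->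
    (forall v, rnorm F (h v) <= r * M v) ->
    linear ((emb F r^-1 *: h) : V -> K^o) /\
    (forall v, rnorm F ((emb F r^-1 *: h) v) <= M v).
  move=> r0 h_lin hM; split=> [a u v|v].
    rewrite /= !fctE (linear_mapD h_lin) functionalZ //.
    by rewrite !scalerDr; congr (_ + _); rewrite scalerA mulrC -scalerA.
  rewrite /= !fctE rnormZ rnorm_emb ger0_norm ?invr_ge0 ?(ltW r0) //.
  by rewrite ler_pdivrMl.
have [g1_lin g1N] := scaled _ _ _ c_gt0 f1_lin f1N.
have [g2_lin g2N] := scaled _ _ _ c_lt1 f2_lin f2N.
have [||||g1E _] := f_ext _ _ (emb F c) (_ : dual_ball F N (emb F c^-1 *: f1))
    (_ : dual_ball F N (emb F (1 - c)^-1 *: f2)).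
- by apply/dual_ballP => //; split=> // v; exact: le_trans (g1N v) (N1N v).
- by apply/dual_ballP => //; split=> // v; exact: le_trans (g2N v) (N2N v).
- by rewrite emb_open_unit // c_gt0 -subr_gt0.
- apply/funext => v; rewrite fE /= !fctE !scalerA -(rmorph1 (emb F)) -rmorphB.
  by rewrite -!rmorphM !mulfV ?gt_eqF // rmorph1 !scale1r.
by left=> v; rewrite -g1E.
Qed.

End dual_balls.

Section suprema_of_seminorms.
Context {R : realType} {K : numFieldType} {F : real_or_complex R K}.
Context {V : lmodType K} {P : Type}.
Variables (D : set P) (s : P -> V -> R).
Hypothesis s_sem : forall x, D x -> seminorm F (s x).
Hypothesis s_bounded : forall v, exists M, forall x, D x -> s x v <= M.

Definition sup_over (A : set P) (v : V) : R := sup [set s x v | x in A].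

Lemma sup_over_ub A x v : A `<=` D -> A x -> s x v <= sup_over A v.
Proof.
move=> AD Ax; apply: ub_le_sup; last by exists x.
have [M sM] := s_bounded v; exists M => _ [y Ay <-].
exact: sM (AD _ Ay).
Qed.

Lemma sup_over_le A c v : 0 <= c -> (forall x, A x -> s x v <= c) ->
  sup_over A v <= c.
Proof.
move=> c0 sc; have [[x Ax]|A0] := pselect (A !=set0).
  by apply: ge_sup; [exists (s x v), x|move=> _ [y Ay <-]; exact: sc].
by rewrite /sup_over ((nonemptyPn A).1 A0) image_set0 sup0.
Qed.

Lemma sup_over_ge0 A v : A `<=` D -> 0 <= sup_over A v.
Proof.
move=> AD; have [[x Ax]|A0] := pselect (A !=set0).
  exact: le_trans (seminorm_ge0 v (s_sem (AD _ Ax))) (sup_over_ub v AD Ax).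
by rewrite /sup_over ((nonemptyPn A).1 A0) image_set0 sup0.
Qed.

Lemma sup_over_seminorm A : A `<=` D -> seminorm F (sup_over A).
Proof.
move=> AD.
have NZ a v : sup_over A (a *: v) <= rnorm F a * sup_over A v.
  apply: sup_over_le => [|x Ax]; first by
    rewrite mulr_ge0 ?rnorm_ge0 ?sup_over_ge0.
  by rewrite (s_sem (AD _ Ax)).2 ler_wpM2l ?rnorm_ge0 ?sup_over_ub.
split=> [u v|a v].
  apply: sup_over_le => [|x Ax]; first by rewrite addr_ge0 ?sup_over_ge0.
  by apply: le_trans ((s_sem (AD _ Ax)).1 u v) _; rewrite lerD ?sup_over_ub.
apply/eqP; rewrite eq_le NZ /=; have [->|a0] := eqVneq a 0.
  by rewrite rnorm0 mul0r sup_over_ge0.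
have := NZ a^-1 (a *: v); rewrite scalerA mulVf // scale1r.
have -> : rnorm F a^-1 = (rnorm F a)^-1.
  apply: (mulfI (rnorm_neq0 (F := F) a0)).
  by rewrite -rnormM !mulfV ?rnorm1 ?rnorm_neq0.
by rewrite ler_pdivlMl // lt_def rnorm_neq0 ?rnorm_ge0.
Qed.

Lemma sup_over_mono A B v : A `<=` B -> B `<=` D ->
  sup_over A v <= sup_over B v.
Proof.
move=> AB BD; apply: sup_over_le => [|x Ax]; first exact: sup_over_ge0.
by apply: sup_over_ub => //; exact: AB.
Qed.

(** Call a set of indices big if [f] is at most the supremum of the seminorms
    over that set. Extremality makes one of two sets big as soon as their union
    is, so the complements of the sets that are not big form a filter; any
    ultrafilter that contains it consists of big sets. *)
Lemma extreme_ultrafilter (f : V -> K^o) :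
  extreme_points (dual_ball F (sup_over D)) f -> (exists v, f v != 0) ->
  exists G : set_system P, [/\ UltraFilter G, G D
    & forall v c, G [set x | s x v <= c] -> rnorm F (f v) <= c].
Proof.
move=> f_ext [v0 fv0]; have N_sem := sup_over_seminorm (@subset_refl _ D).
have ID (A : set P) : A `&` D `<=` D by exact: subIsetr.
have [f_lin fN] : linear f /\ forall v, rnorm F (f v) <= sup_over D v.
  by apply/(dual_ballP _ N_sem); exact: f_ext.1.
pose big (A : set P) := forall v, rnorm F (f v) <= sup_over (A `&` D) v.
have big0 A : A `&` D = set0 -> ~ big A.
  move=> A0 /(_ v0); rewrite A0 /sup_over image_set0 sup0 => fv.
  move/eqP: fv0; apply; apply: (rnorm_eq0 (F := F)).
  by apply/eqP; rewrite eq_le fv rnorm_ge0.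
have bigS A B : A `<=` B -> big A -> big B.
  move=> AB bA v; apply: le_trans (bA v) _; apply: sup_over_mono => //.
  exact: setSI.
have bigU A B : big (A `|` B) -> big A \/ big B.
  move=> bAB; apply: (extreme_dominated_by_max N_sem (sup_over_seminorm (ID A))
    (sup_over_seminorm (ID B))) => // [v|v|v]; try exact: sup_over_mono.
  apply: le_trans (bAB v) _; apply: sup_over_le => [|x [[Ax|Bx] Dx]].
  - by rewrite le_max sup_over_ge0.
  - by rewrite le_max; apply/orP; left; apply: sup_over_ub.
  - by rewrite le_max; apply/orP; right; apply: sup_over_ub.
pose G0 : set_system P := [set A | ~ big (~` A)].
have G0_proper : ProperFilter G0.
  apply: Build_ProperFilter_ex => [A|].
    apply: contra_notP => /nonemptyPn -> ; rewrite setC0 => v.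
    by rewrite setTI.
  split=> [|A B nA nB|A B AB nA].
  - by apply: big0; rewrite setCT set0I.
  - by rewrite /G0 /= setCI => /bigU[].
  - by move=> bB; apply: nA; apply: bigS bB; exact: subsetC.
have [G [G_ultra G0G]] := ultraFilterLemma G0_proper.
have G_big A : G A -> big A.
  move=> GA; apply: contrapT => nbA.
  have /(filterI GA) : G (~` A) by apply: G0G; rewrite /G0 /= setCK.
  by rewrite setICr => /filter_ex[].
have GD : G D by apply: G0G; apply: big0; exact: setICl.
exists G; split=> // v c Gc.
have c0 : 0 <= c.
  have [x [/= xc Dx]] := filter_ex (filterI Gc GD).
  exact: le_trans (seminorm_ge0 v (s_sem Dx)) xc.
by apply: le_trans (G_big _ Gc v) _; apply: sup_over_le => // x [].
Qed.

End suprema_of_seminorms.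

(** * Limits along an ultrafilter in finite dimension *)

Section ultrafilter_limits.
Context {R : realType} {K : numFieldType} {F : real_or_complex R K}.
Context {P : Type} {G : set_system P} {G_ultra : UltraFilter G}.

(** The errors are measured by the real-valued norm, so that limits of scalars
    and of vectors over both fields are covered by the same estimates. *)
Definition limit_along (V : normedZmodType K) (u : P -> V) (l : V) : Prop :=
  forall e : R, 0 < e -> G [set x | rnorm F (u x - l) <= e].

Lemma limit_along_cst (V : normedZmodType K) (l : V) :
  limit_along (fun=> l) l.
Proof.
by move=> e e0; apply: filterS filterT => x _ /=; rewrite subrr rnorm0 ltW.
Qed.

Lemma limit_along_lipschitz (V W : normedZmodType K) (u : P -> V) (w : P -> W)
    l m k :
  0 <= k -> limit_along w m ->
  (forall x, rnorm F (u x - l) <= k * rnorm F (w x - m)) -> limit_along u l.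
Proof.
move=> k0 wm uw e e0; have k1 : 0 < k + 1 by lra.
apply: filterS (wm (e / (k + 1)) (divr_gt0 e0 k1)) => x /= wx.
apply: le_trans (uw x) _; apply: le_trans (_ : (k + 1) * (e / (k + 1)) <= e).
  by rewrite ler_pM ?rnorm_ge0 // lerDl.
by rewrite mulrC divfK ?gt_eqF.
Qed.

Lemma limit_along_add (V : normedZmodType K) (u v : P -> V) l m :
  limit_along u l -> limit_along v m ->
  limit_along (fun x => u x + v x) (l + m).
Proof.
move=> ul vm e e0; have e2 : 0 < e / 2 by lra.
apply: filterS (filterI (ul _ e2) (vm _ e2)) => x [/= ux vx].
by rewrite opprD addrACA; apply: le_trans (rnormD _ _) _; lra.
Qed.

Lemma limit_along_sum (V : normedZmodType K) I (r : seq I) (u : I -> P -> V)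
    (l : I -> V) : (forall i, limit_along (u i) (l i)) ->
  limit_along (fun x => \sum_(i <- r) u i x) (\sum_(i <- r) l i).
Proof.
move=> ul; elim: r => [|i r IH].
  rewrite big_nil; under [X in limit_along X _]funext => x do rewrite big_nil.
  exact: limit_along_cst.
rewrite big_cons; under [X in limit_along X _]funext => x do rewrite big_cons.
exact: limit_along_add.
Qed.

Lemma limit_along_scale (V : normedModType K) (u : P -> V) a l :
  limit_along u l -> limit_along (fun x => a *: u x) (a *: l).
Proof.
move=> ul; apply: (limit_along_lipschitz (rnorm_ge0 a) ul) => x.
by rewrite -scalerBr rnormZ.
Qed.

Lemma limit_along_scalel (V : normedModType K) (c : P -> K) l (v : V) :
  limit_along c l -> limit_along (fun x => c x *: v) (l *: v).
Proof.
move=> cl; apply: (limit_along_lipschitz (rnorm_ge0 v) cl) => x.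
by rewrite -scalerBl rnormZ mulrC.
Qed.

Lemma limit_along_bound (V : normedZmodType K) (u : P -> V) l M :
  limit_along u l -> G [set x | rnorm F (u x) <= M] -> rnorm F l <= M.
Proof.
move=> ul uM; apply/ler_addgt0Pr => e e0.
have [x [/= ux uxl]] := filter_ex (filterI uM (ul e e0)).
have -> : l = u x - (u x - l) by rewrite subKr.
by apply: le_trans (rnormD _ _) _; rewrite rnormN lerD.
Qed.

Lemma limit_along_unique (V : normedZmodType K) (u : P -> V) l m :
  limit_along u l -> limit_along u m -> l = m.
Proof.
move=> ul um; apply/eqP; rewrite -subr_eq0; apply/eqP/(rnorm_eq0 (F := F)).
apply/eqP; rewrite eq_le rnorm_ge0 andbT; apply/ler_addgt0Pr => e e0.
have e2 : 0 < e / 2 by lra.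
have [x [/= xl xm]] := filter_ex (filterI (ul _ e2) (um _ e2)).
have -> : l - m = (u x - m) - (u x - l) by rewrite opprB [RHS]addrC addrA subrK.
by apply: le_trans (rnormD _ _) _; rewrite rnormN add0r; lra.
Qed.

Lemma bounded_real_limit (u : P -> R) M : G [set x | `|u x| <= M] ->
  exists l, forall e : R, 0 < e -> G [set x | `|u x - l| <= e].
Proof.
move=> uM; pose S := [set c | G [set x | c <= u x]].
have SM : S (- M).
  by apply: filterS uM => x /=; rewrite ler_norml => /andP[].
have S_ub : ubound S M.
  move=> c Sc; have [x [/= cx]] := filter_ex (filterI Sc uM).
  by rewrite ler_norml => /andP[_]; exact: le_trans.
exists (sup S) => e e0.
have S_below : G [set x | sup S - e <= u x].
  have [c Sc cS] : exists2 c, S c & sup S - e < c.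
    by apply: sup_adherent => //; split; [exists (- M)|exists M].
  by apply: filterS Sc => x /=; apply: le_trans (ltW cS).
have S_above : G (~` [set x | sup S + e <= u x]).
  have [Se|//] := in_ultra_setVsetC [set x | sup S + e <= u x] G_ultra.
  have : sup S + e <= sup S by apply: ub_le_sup; [exists M|exact: Se].
  by rewrite gerDl leNgt e0.
apply: filterS (filterI S_below S_above) => x [/= lo /negP].
rewrite -ltNge => hi.
by rewrite ler_distl lo ltW.
Qed.

End ultrafilter_limits.

Arguments limit_along {R K} F {P} G {V}.

Lemma bounded_scalar_limit (R : realType) (K : numFieldType)
    (F : real_or_complex R K) (P : Type) (G : set_system P) (u : P -> K) M :
  UltraFilter G -> G [set x | rnorm F (u x) <= M] ->
  exists l, limit_along F G u l.
Proof.
move=> G_ultra; case: F u => u uM; first exact: bounded_real_limit uM.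
have bounded_part (h : P -> R) : (forall x, `|h x|%:C%C <= `|u x|) ->
    exists l, forall e : R, 0 < e -> G [set x | `|h x - l| <= e].
  move=> hu; apply: (@bounded_real_limit _ _ _ _ _ M).
  apply: filterS uM => x /=; apply: le_trans.
  by have := hu x; rewrite -(emb_rnorm (F := ComplexScalars R)) lecR.
have [a ua] := bounded_part _ (fun x => normc_ge_Re (u x)).
have [|b ub] := bounded_part (fun x => complex.Im (u x)).
  move=> x; have := normc_ge_Re ('i * u x)%C; rewrite normrM normc_def /=.
  rewrite expr0n expr1n /= add0r sqrtr1 mul1r.
  by case: (u x) => y z /=; rewrite mul0r mul1r sub0r normrN.
exists (a +i* b)%C => e e0; have e2 : 0 < e / 2 by lra.
apply: filterS (filterI (ua _ e2) (ub _ e2)) => x [].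
rewrite /mkset => xa xb.
have -> : u x - (a +i* b)%C = emb (ComplexScalars R) (complex.Re (u x) - a) +
    (0 +i* 1)%C * emb (ComplexScalars R) (complex.Im (u x) - b).
  by case: (u x) => y z; apply/eqP; rewrite eq_complex /=; apply/andP; split;
    apply/eqP; ring.
apply: le_trans (rnormD _ _) _; rewrite rnormM !rnorm_emb.
have -> : rnorm (ComplexScalars R) (0 +i* 1)%C = 1.
  by rewrite /rnorm normc_def /= expr0n expr1n /= add0r sqrtr1.
by rewrite mul1r; lra.
Qed.

Section finite_dimension.
Context {R : realType} {K : numFieldType} {F : real_or_complex R K}.
Variable X : normedModType K.

(** Induction on the number of vectors. If the first vector is in the span of
    the others it can be dropped. Otherwise it has positive distance to that
    span: vectors of the span approaching it would have bounded coordinates by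
    the induction hypothesis, and a limit of the coordinates would put it in
    the span. The distance bounds the first coordinate. *)
Lemma bounded_coordinates n (e : 'I_n -> X) : exists2 M, 0 <= M &
  forall c : 'I_n -> K, exists2 b : 'I_n -> K,
    \sum_(i < n) b i *: e i = \sum_(i < n) c i *: e i &
    forall i, rnorm F (b i) <= M * rnorm F (\sum_(i < n) c i *: e i).
Proof.
elim: n e => [|n IH] e.
  by exists 0 => // c; exists c => // -[].
have [M M0 e_coord] := IH (fun i => e (lift ord0 i)).
pose cons_fun (t : K) (b : 'I_n -> K) (i : 'I_n.+1) :=
  if unlift ord0 i is Some j then b j else t.
have sum_cons t b : \sum_(i < n.+1) cons_fun t b i *: e i =
    t *: e ord0 + \sum_(i < n) b i *: e (lift ord0 i).
  rewrite big_ord_recl /cons_fun unlift_none; congr (_ + _).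
  by apply: eq_bigr => i _; rewrite liftK.
have [[b e0E]|e0_notin] :=
    pselect (exists b, e ord0 = \sum_(i < n) b i *: e (lift ord0 i)).
  exists M => // c.
  have [b' b'E b'M] := e_coord (fun i => c ord0 * b i + c (lift ord0 i)).
  have cE : \sum_(i < n) (c ord0 * b i + c (lift ord0 i)) *: e (lift ord0 i) =
      \sum_(i < n.+1) c i *: e i.
    rewrite big_ord_recl e0E scaler_sumr -big_split; apply: eq_bigr => i _.
    by rewrite /= scalerDl scalerA.
  rewrite cE in b'E b'M.
  exists (cons_fun 0 b'); first by rewrite sum_cons scale0r add0r.
  move=> i; rewrite /cons_fun; case: unliftP => [j _|_]; first exact: b'M.
  by rewrite (rnorm0 (F := F) K) mulr_ge0 // rnorm_ge0.
have [delta delta0 e0_far] : exists2 delta, 0 < delta & forall b : 'I_n -> K,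
    delta <= rnorm F (\sum_(i < n) b i *: e (lift ord0 i) + e ord0).
  apply: contrapT => near; apply: e0_notin.
  have approx (k : nat) : exists b : 'I_n -> K,
      rnorm F (\sum_(i < n) b i *: e (lift ord0 i) + e ord0) <= k.+1%:R^-1 /\
      forall i, rnorm F (b i) <= M * (1 + rnorm F (e ord0)).
    apply: contrapT => far; apply: near; exists k.+1%:R^-1 => [|c].
      by rewrite invr_gt0 ltr0n.
    rewrite leNgt; apply/negP => /ltW c_near; apply: far.
    have [b bE bM] := e_coord c; exists b; rewrite bE; split=> // i.
    apply: le_trans (bM i) _; rewrite ler_wpM2l //.
    rewrite -[X in rnorm F X](addrK (e ord0)).
    apply: le_trans (rnormD _ _) _; rewrite rnormN lerD2r.
    apply: le_trans c_near _.
    by rewrite invf_le1 ?ltr0n // ler1n.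
  have [b bP] := choice approx.
  have [G [G_ultra ooG]] := ultraFilterLemma (@eventually_filter).
  have b_lim i : exists l, limit_along F G (fun k => b k i) l.
    apply: bounded_scalar_limit; apply: filterS filterT => k _ /=.
    exact: (bP k).2.
  have [l lP] := choice b_lim.
  have lim_sum : limit_along F G
      (fun k => \sum_(i < n) b k i *: e (lift ord0 i))
      (\sum_(i < n) l i *: e (lift ord0 i)).
    apply: limit_along_sum => i; exact: limit_along_scalel.
  have lim_e0 : limit_along F G
      (fun k => \sum_(i < n) b k i *: e (lift ord0 i)) (- e ord0).
    move=> eps eps0; apply: ooG; near=> k; rewrite /= opprK.
    apply: le_trans (bP k).1 _; apply/ltW; near: k.
    exact: near_infty_natSinv_lt (PosNum eps0).
  exists (fun i => - l i).
  rewrite -[LHS]opprK (limit_along_unique lim_e0 lim_sum).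
  by rewrite -sumrN; apply: eq_bigr => i _; rewrite scaleNr.
have Md0 : 0 <= M * (1 + rnorm F (e ord0) / delta).
  by rewrite mulr_ge0 // addr_ge0 // divr_ge0 ?rnorm_ge0 // ltW.
have di : 0 < delta^-1 by rewrite invr_gt0.
exists (M * (1 + rnorm F (e ord0) / delta) + delta^-1) => [|c].
  by rewrite addr_ge0 // ltW.
set x := \sum_(i < n.+1) c i *: e i.
have xE : x =
    c ord0 *: e ord0 + \sum_(i < n) c (lift ord0 i) *: e (lift ord0 i).
  exact: big_ord_recl.
have x0 := rnorm_ge0 (F := F) x.
have c0x : rnorm F (c ord0) <= delta^-1 * rnorm F x.
  rewrite ler_pdivlMl //; have [->|c0] := eqVneq (c ord0) 0.
    by rewrite (rnorm0 (F := F) K) mulr0.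
  have := e0_far (fun i => (c ord0)^-1 * c (lift ord0 i)).
  rewrite -(ler_pM2l (x := rnorm F (c ord0))); last first.
    by rewrite lt_def rnorm_neq0 ?rnorm_ge0.
  rewrite -rnormZ scalerDr scaler_sumr mulrC xE addrC.
  by under eq_bigr do rewrite scalerA mulVKf //.
have [b bE bM] := e_coord (fun i => c (lift ord0 i)).
exists (cons_fun (c ord0) b); first by rewrite sum_cons bE -xE.
have tail_le : rnorm F (\sum_(i < n) c (lift ord0 i) *: e (lift ord0 i)) <=
    (1 + rnorm F (e ord0) / delta) * rnorm F x.
  rewrite -[X in rnorm F X](addKr (c ord0 *: e ord0)) -xE addrC.
  apply: le_trans (rnormD _ _) _; rewrite rnormN rnormZ mulrDl mul1r lerD2l.
  by rewrite mulrC -mulrA ler_wpM2l ?rnorm_ge0.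
move=> i; rewrite mulrDl /cons_fun; case: unliftP => [j _|_].
  apply: le_trans (bM j) _; apply: le_trans (ler_wpM2l M0 tail_le) _.
  by rewrite mulrA lerDl mulr_ge0 // ltW.
by apply: le_trans c0x _; rewrite lerDr mulr_ge0.
Unshelve. all: by end_near. Qed.

Lemma findim_bounded_limit (P : Type) (G : set_system P) (u : P -> X) M :
  finite_dimensional X -> UltraFilter G -> G [set x | rnorm F (u x) <= M] ->
  exists l, limit_along F G u l.
Proof.
move=> [n [e e_span]] G_ultra uM.
have [C C0 e_coord] := bounded_coordinates e.
have coords x : exists b : 'I_n -> K, u x = \sum_(i < n) b i *: e i /\
    forall i, rnorm F (b i) <= C * rnorm F (u x).
  have [c ->] := e_span (u x).
  by have [b bE bC] := e_coord c; exists b.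
have [b bP] := choice coords.
have b_lim i : exists l, limit_along F G (fun x => b x i) l.
  apply: (@bounded_scalar_limit _ _ _ _ _ _ (C * M)).
  apply: filterS uM => x /= ux.
  by apply: le_trans ((bP x).2 i) _; rewrite ler_wpM2l.
have [l lP] := choice b_lim; exists (\sum_(i < n) l i *: e i).
rewrite (_ : u = fun x => \sum_(i < n) b x i *: e i); last first.
  by apply/funext => x; exact: (bP x).1.
by apply: limit_along_sum => i; exact: limit_along_scalel.
Qed.

End finite_dimension.

(** * The joint numerical radius *)

Section bounded_operator_theory.
Context {R : realType} {K : numFieldType} (F : real_or_complex R K).
Context {X : normedModType K}.
Implicit Types (S T : bounded_op X) (x : X).

Lemma bounded_op_linear T : linear T.
Proof. by case: T => T /= /asboolP[]. Qed.

Lemma bounded_op_bound T :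
  exists2 M, 0 <= M & forall x, rnorm F (T x) <= M * rnorm F x.
Proof.
case: T => T /= /asboolP[_ [M TM]]; exists (rnorm F M) => [|x].
  exact: rnorm_ge0.
rewrite -(le_emb (F := F)) rmorphM /= !emb_rnorm.
have /ger0_norm : 0 <= M * `|x| by apply: le_trans (TM x).
by rewrite normrM normr_id => ->.
Qed.

Lemma bounded_op_of (h : X -> X) (M : R) :
  linear h -> (forall x, rnorm F (h x) <= M * rnorm F x) ->
  exists T, forall x, T x = h x.
Proof.
move=> h_lin hM; suff hP : h \in @bounded_linear K X by exists (BoundedOp hP).
apply/asboolP; split=> //; exists (emb F M) => x.
by rewrite -!(emb_rnorm (F := F)) -rmorphM le_emb.
Qed.

Lemma identity_op : exists T, forall x, T x = x.
Proof. by apply: (@bounded_op_of _ 1) => // x; rewrite mul1r. Qed.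

Lemma rank_one_op (g : X -> K^o) (u : X) :
  linear g -> (forall v, rnorm F (g v) <= rnorm F v) ->
  exists T, forall x, T x = g x *: u.
Proof.
move=> g_lin gN; apply: (@bounded_op_of _ (rnorm F u)) => [a v w|v].
  by rewrite g_lin scalerDl -scalerA.
by rewrite rnormZ mulrC ler_wpM2l ?rnorm_ge0 ?gN.
Qed.

End bounded_operator_theory.

Section states.
Context {R : realType} {K : numFieldType} {F : real_or_complex R K}.
Context {X : normedModType K}.

Lemma Pi_statesP (x : X) (f : X -> K^o) :
  Pi_states F (x, f) <->
  [/\ rnorm F x = 1, linear f, forall v, rnorm F (f v) <= rnorm F v & f x = 1].
Proof.
split=> [[/= x1 [f_dual f1] fx]|[x1 f_lin fN fx]].
  have [|f_lin fN] := (dual_ballP f (@norm_seminorm _ _ F X)).1; last by split.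
  by split; rewrite ?f1.
have [f_dual f1] := (dual_ballP f (@norm_seminorm _ _ F X)).2 (conj f_lin fN).
split=> //; split=> //; apply/eqP; rewrite eq_le f1 /=.
apply: ub_le_sup; last by exists x; rewrite /= ?x1 // fx -(rnorm1 (F := F)).
by exists 1 => _ [v v1 <-]; exact: le_trans (fN v) v1.
Qed.

(** The imaginary part vanishes because the sum of the squares of both parts is
    the square of the modulus. *)
Lemma eq_emb_of_real_part (x : K) :
  rnorm F x <= real_part F x -> x = emb F (real_part F x).
Proof.
case: F x => [//|] x x_le; have x0 := rnorm_ge0 (F := ComplexScalars R) x.
have := add_Re2_Im2 x; rewrite -(emb_rnorm (F := ComplexScalars R)).
move: x_le x0; move: (rnorm _ _) => r; case: x => a b /= ra r0 [+ _].
rewrite mul0r subr0 => abr.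
by have -> : b = 0 by apply/eqP; rewrite -sqrf_eq0; apply/eqP; nra.
Qed.

(** The real parts of the two end points are at most [1], hence equal to it,
    and a scalar of modulus at most [1] with real part [1] is [1]. *)
Lemma unit_disc_extreme (a b : K) (t : R) : 0 < t < 1 ->
  rnorm F a <= 1 -> rnorm F b <= 1 ->
  1 = emb F t * a + (1 - emb F t) * b -> a = 1 /\ b = 1.
Proof.
move=> /andP[t0 t1] a1 b1 abt.
have {abt} : 1 = t * real_part F a + (1 - t) * real_part F b.
  rewrite -!(real_part_embM (F := F)) rmorphB rmorph1 -raddfD -abt.
  by rewrite -(rmorph1 (emb F)) /= real_part_emb.
have := real_part_le (F := F) a; have := real_part_le (F := F) b => bN aN abt.
have aE : real_part F a = 1 by nra.
have bE : real_part F b = 1 by nra.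
split; first by have := @eq_emb_of_real_part a; rewrite aE rmorph1; exact.
by have := @eq_emb_of_real_part b; rewrite bE rmorph1; exact.
Qed.

End states.

Section extreme_functionals.
Context {R : realType} {K : numFieldType} {F : real_or_complex R K}.
Context {X : normedModType K} {d : nat} {p q : R}.
Hypothesis d_gt0 : (0 < d)%N.
Hypothesis pq : conjugate_exponents p q.
Implicit Types (T : 'I_d -> bounded_op X) (x : X) (f : X -> K^o).

Definition state_norm (xf : X * (X -> K^o)) T : R :=
  lp_norm F p (fun i => xf.2 (T i xf.1)).

Lemma state_norm_seminorm xf : Pi_states F xf -> seminorm F (state_norm xf).
Proof.
case: xf => x f /Pi_statesP[_ f_lin _ _]; have [p0 _ _] := pq.
split=> [S T|a T]; rewrite /state_norm /=.
  rewrite (_ : (fun i => f ((S + T) i x)) = fun i => f (S i x) + f (T i x)).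
    exact: lp_normD pq.
  by apply/funext => i; rewrite -(linear_mapD f_lin).
rewrite -(lp_normZ _ _ p0); congr (lp_norm F p _); apply/funext => i.
by rewrite -functionalZ.
Qed.

Lemma state_norm_bounded T :
  exists M, forall xf, Pi_states F xf -> state_norm xf T <= M.
Proof.
have bnd i : exists M, forall x, rnorm F (T i x) <= M * rnorm F x.
  by have [M _ TM] := bounded_op_bound F (T i); exists M.
have [M TM] := choice bnd; exists (\sum_(i < d) M i).
move=> [x f] /Pi_statesP[x1 f_lin fN fx].
apply: le_trans (lp_norm_le_sum _ d_gt0 pq) _; apply: ler_sum => i _ /=.
by apply: le_trans (fN _) _; have := TM i x; rewrite x1 mulr1.
Qed.

Lemma joint_numerical_radius_seminorm :
  seminorm F (joint_numerical_radius F X d p).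
Proof.
exact: (sup_over_seminorm state_norm_seminorm state_norm_bounded).
Qed.

Lemma state_norm_le_radius xf T : Pi_states F xf ->
  state_norm xf T <= joint_numerical_radius F X d p T.
Proof.
by move=> xfP; apply: (sup_over_ub state_norm_bounded _ (@subset_refl _ _) xfP).
Qed.

Lemma tensor_functional_linear (a : 'I_d -> K) f x :
  linear f -> linear (tensor_functional a f x).
Proof.
move=> f_lin c S T; rewrite /tensor_functional scaler_sumr -big_split /=.
apply: eq_bigr => i _.
have -> : f ((c *: S + T) i x) = c * f (S i x) + f (T i x) by rewrite -f_lin.
by rewrite mulrDr mulrCA.
Qed.

Lemma tensor_functional_ball (a : 'I_d -> K) f x :
  Pi_states F (x, f) -> lp_norm F q a <= 1 ->
  dual_ball F (joint_numerical_radius F X d p) (tensor_functional a f x).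
Proof.
move=> xfP a1; apply/(dual_ballP _ joint_numerical_radius_seminorm); split.
  by case/Pi_statesP: xfP => _ f_lin _ _; exact: tensor_functional_linear.
move=> T; apply: le_trans (hoelder_lp_norm _ _ pq) _.
apply: le_trans (state_norm_le_radius T xfP).
by rewrite ler_piMl ?lp_norm_ge0.
Qed.

(** The states of an ultrafilter of big sets converge, because [X] has finite
    dimension, and the limit is again a state. *)
Lemma extreme_dominated_by_state (phi : ('I_d -> bounded_op X) -> K^o) :
  finite_dimensional X ->
  extreme_points (dual_ball F (joint_numerical_radius F X d p)) phi ->
  (exists T, phi T != 0) ->
  exists xf, Pi_states F xf /\ forall T, rnorm F (phi T) <= state_norm xf T.
Proof.
move=> X_findim phi_ext phi_neq0.
have [G [G_ultra GPi phiG]] := extreme_ultrafilter state_norm_seminorm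
  state_norm_bounded phi_ext phi_neq0.
have [x0 x0P] : exists x0, limit_along F G (fun xf : X * (X -> K^o) => xf.1) x0.
  apply: (findim_bounded_limit (M := 1)) => //.
  by apply: filterS GPi => -[x f] /Pi_statesP[/= -> _ _ _].
have f_lim v : exists l : K,
    limit_along F G (fun xf : X * (X -> K^o) => xf.2 v : K) l.
  apply: (bounded_scalar_limit (M := rnorm F v)).
  by apply: filterS GPi => -[x f] /Pi_statesP[_ _ fN _]; exact: fN.
have [f0 f0P] := choice f_lim.
(* The values converge at convergent arguments, because the functionals of the
   states are uniformly Lipschitz. *)
have value_lim (u : X * (X -> K^o) -> X) l : limit_along F G u l ->
    limit_along F G (fun xf => xf.2 (u xf) : K) (f0 l).
  move=> ul e e0; have e2 : 0 < e / 2 by lra.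
  apply: filterS (filterI GPi (filterI (ul _ e2) (f0P l _ e2))).
  move=> [x f] [/Pi_statesP[/= _ f_lin fN _] [/= u_near f_near]].
  have -> : (f (u (x, f)) : K) - f0 l = f (u (x, f) - l) + (f l - f0 l).
    by rewrite (linear_mapB f_lin) addrA subrK.
  apply: le_trans (rnormD _ _) _.
  by have := le_trans (fN _) u_near; lra.
have f0_lin : linear (f0 : X -> K^o).
  move=> a u v; apply: (limit_along_unique (F := F) (G := G) (f0P _)).
  have lim_uv : limit_along F G (fun xf => a *: xf.2 u + xf.2 v : K^o)
      (a *: (f0 u : K^o) + f0 v).
    by apply: limit_along_add (f0P v); apply: limit_along_scale (f0P u).
  move=> e e0; apply: filterS (filterI GPi (lim_uv e e0)).
  by move=> [x f] [/Pi_statesP[_ f_lin _ _]] /=; rewrite f_lin.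
have f0N v : rnorm F (f0 v) <= rnorm F v.
  apply: limit_along_bound (f0P v) _.
  by apply: filterS GPi => -[x f] /Pi_statesP[_ _ fN _]; exact: fN.
have f0x0 : f0 x0 = 1.
  apply: (limit_along_unique (F := F) (value_lim _ _ x0P)) => e e0.
  apply: filterS GPi => -[x f] /Pi_statesP[/= _ _ _ ->].
  by rewrite subrr rnorm0 ltW.
have x01 : rnorm F x0 = 1.
  apply/eqP; rewrite eq_le; apply/andP; split.
    apply: limit_along_bound x0P _.
    by apply: filterS GPi => -[x f] /Pi_statesP[/= -> _ _ _].
  by have := f0N x0; rewrite f0x0 (rnorm1 (F := F)).
exists (x0, f0); split=> [|T]; first exact/Pi_statesP.
apply/ler_addgt0Pr => e e0; apply: phiG.
have T_lim i : limit_along F G (fun xf => xf.2 (T i xf.1) : K) (f0 (T i x0)).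
  apply: value_lim; have [M M0 TM] := bounded_op_bound F (T i).
  apply: (limit_along_lipschitz M0 x0P) => xf.
  by rewrite -(linear_mapB (bounded_op_linear (T i))).
have ed : 0 < e / d%:R by rewrite divr_gt0 // ltr0n.
have near_T : G [set xf | forall i : 'I_d,
    rnorm F ((xf.2 (T i xf.1) : K) - f0 (T i x0)) <= e / d%:R].
  by apply: filter_forall => i; exact: T_lim.
apply: filterS near_T => xf /= xf_near.
have -> : state_norm xf T = lp_norm F p (fun i =>
    f0 (T i x0) + ((xf.2 (T i xf.1) : K) - f0 (T i x0))).
  by congr lp_norm; apply/funext => i; rewrite addrC subrK.
apply: le_trans (lp_normD _ _ d_gt0 pq) _; rewrite lerD2l.
apply: le_trans (lp_norm_le_sum _ d_gt0 pq) _.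
apply: le_trans (ler_sum _ (fun i _ => xf_near i)) _.
by rewrite sumr_const card_ord -[_ *+ d]mulr_natr divfK // pnatr_eq0 -lt0n.
Qed.

End extreme_functionals.

(** * Tensor functionals and their extremality *)

Section tensor_functionals.
Context {R : realType} {K : numFieldType} {F : real_or_complex R K}.
Context {X : normedModType K} {d : nat} {p q : R}.
Hypothesis d_gt0 : (0 < d)%N.
Hypothesis pq : conjugate_exponents p q.
Implicit Types (T : 'I_d -> bounded_op X) (f g : X -> K^o) (a b : 'I_d -> K).

(** A tuple [T] differs from the tuple of the scalar operators [f (T i x)] by a
    tuple on which the state [(x, f)] vanishes, so [phi] only sees these
    scalars. *)
Lemma tensor_of_state_dominated x f (phi : ('I_d -> bounded_op X) -> K^o) :
  Pi_states F (x, f) -> linear phi ->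
  (forall T, rnorm F (phi T) <= state_norm (F := F) (p := p) (x, f) T) ->
  exists2 a, lp_norm F q a <= 1 & phi = tensor_functional a f x.
Proof.
move=> /Pi_statesP[x1 f_lin fN fx] phi_lin phi_le; have [p0 q0 _] := pq.
have [Id IdE] := identity_op F (X := X).
pose scalar_tuple b : 'I_d -> bounded_op X := fun i => b i *: Id.
pose a j := phi (scalar_tuple (fun i => (i == j)%:R)).
have phi_scalar b : phi (scalar_tuple b) = \sum_(j < d) b j * a j.
  have -> : scalar_tuple b =
      \sum_(j < d) b j *: scalar_tuple (fun i => (i == j)%:R).
    apply/funext => i; rewrite fct_sumE (bigD1 i) //= big1 => [|j ji].
      by rewrite addr0 /scalar_tuple fctE eqxx scale1r.
    by rewrite /scalar_tuple fctE eq_sym (negPf ji) scale0r scaler0.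
  rewrite (linear_map_sum phi_lin); apply: eq_bigr => j _.
  by rewrite (functionalZ _ _ phi_lin).
have state_scalar b :
    state_norm (F := F) (p := p) (x, f) (scalar_tuple b) = lp_norm F p b.
  congr lp_norm; apply/funext => i; rewrite -[LHS]/(f (b i *: Id x)) IdE.
  by rewrite (functionalZ _ _ f_lin) fx mulr1.
exists a.
  have [b b1 ba] :=
    hoelder_extremal (F := F) a d_gt0 (conjugate_exponents_sym pq).
  have := phi_le (scalar_tuple b); rewrite phi_scalar ba state_scalar b1.
  by rewrite (rnorm_emb (F := F)) ger0_norm ?lp_norm_ge0.
apply/funext => T; rewrite /tensor_functional.
pose b i : K := f (T i x).
have <- : phi (scalar_tuple b) = \sum_(i < d) a i * b i.
  by rewrite phi_scalar; apply: eq_bigr => i _; rewrite mulrC.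
apply/eqP; rewrite -subr_eq0 -(linear_mapB phi_lin); apply/eqP.
apply: (rnorm_eq0 (F := F)); apply/eqP; rewrite eq_le rnorm_ge0 andbT.
apply: le_trans (phi_le _) _; apply: le_trans (lp_norm_le_sum _ d_gt0 pq) _.
rewrite big1 // => i _.
rewrite -[X in rnorm F X]/(f (T i x - b i *: Id x)) IdE.
rewrite (linear_mapB f_lin) (functionalZ _ _ f_lin) fx mulr1 subrr.
exact: rnorm0.
Qed.

Definition single_op (j : 'I_d) (S : bounded_op X) : 'I_d -> bounded_op X :=
  fun i => if i == j then S else 0.

Lemma tensor_functional_single a f x j S : linear f ->
  tensor_functional a f x (single_op j S) = a j * f (S x).
Proof.
move=> f_lin; rewrite /tensor_functional (bigD1 j) //= /single_op eqxx.
rewrite big1 ?addr0 // => i /negPf ->.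
by rewrite (linear_map0 f_lin : f ((0 : bounded_op X) x) = 0) mulr0.
Qed.

(** The operator [f (.) u] recovers the value at [u]. *)
Lemma tensor_functional_inj_functional a f g x j :
  Pi_states F (x, f) -> linear g -> a j != 0 ->
  tensor_functional a g x = tensor_functional a f x -> g = f.
Proof.
move=> /Pi_statesP[_ f_lin fN fx] g_lin aj gf; apply/funext => u.
have [S SE] := rank_one_op (F := F) u f_lin fN.
have := congr1 (fun psi => psi (single_op j S)) gf.
by rewrite !tensor_functional_single // SE fx scale1r => /(mulfI aj).
Qed.

(** The operator [g (.) x], with [g] norming [y - x], tells [y] from [x]. *)
Lemma tensor_functional_inj_point a f x y j :
  Pi_states F (x, f) -> a j != 0 ->
  tensor_functional a f y = tensor_functional a f x -> y = x.
Proof.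
move=> /Pi_statesP[_ f_lin fN fx] aj yx.
have [g [g_lin gN gyx]] := norming_functional (F := F) (y - x).
have [S SE] := rank_one_op (F := F) x g_lin gN.
have := congr1 (fun psi => psi (single_op j S)) yx.
rewrite !tensor_functional_single // !SE !(functionalZ _ _ f_lin) fx !mulr1.
move=> /(mulfI aj) gE.
apply/eqP; rewrite -subr_eq0; apply/eqP/(rnorm_eq0 (F := F)).
apply: (fmorph_inj (emb F)); rewrite rmorph0 /= -gyx (linear_mapB g_lin) gE.
exact: subrr.
Qed.

Lemma state_exists : (exists x : X, x <> 0) ->
  exists xf : X * (X -> K^o), Pi_states F xf.
Proof.
move=> [v /eqP v0]; have nv := rnorm_neq0 (F := F) v0.
have [g [g_lin gN gv]] := norming_functional (F := F) v.
exists (emb F (rnorm F v)^-1 *: v, g); apply/Pi_statesP; split=> //.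
  by rewrite rnormZ rnorm_emb ger0_norm ?invr_ge0 ?rnorm_ge0 // mulVf.
by rewrite (functionalZ _ _ g_lin) gv -rmorphM mulVf // rmorph1.
Qed.

Let ball := dual_ball F (joint_numerical_radius F X d p).

(** Zero is the midpoint of a nonzero tensor functional and its opposite. *)
Lemma extreme_nonzero (phi : ('I_d -> bounded_op X) -> K^o) :
  (exists x : X, x <> 0) -> extreme_points ball phi -> exists T, phi T != 0.
Proof.
have [h h01 hE] : exists2 h : R, 0 < h < 1 & 1 - h = h.
  by exists 2^-1; [apply/andP; split; lra|lra].
move=> X_neq0 [_ phi_ext]; apply: contrapT => phi0.
have {}phi0 T : phi T = 0.
  by apply/eqP; apply: contra_notT phi0 => ?; exists T.
have [[x f] xfP] := state_exists X_neq0.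
have [_ f_lin _ fx] := (Pi_statesP _ _).1 xfP; have [_ q0 _] := pq.
pose j := Ordinal d_gt0; pose a (i : 'I_d) : K := (i == j)%:R.
have a1 : lp_norm F q a = 1 by exact: lp_norm_delta.
have aN1 : lp_norm F q (fun i => - 1 * a i) = 1.
  by rewrite lp_normZ // rnormN (rnorm1 (F := F)) mul1r.
have [||||aE _] := phi_ext _ _ (emb F h)
    (tensor_functional_ball d_gt0 pq (a := a) xfP _)
    (tensor_functional_ball d_gt0 pq (a := fun i => - 1 * a i) xfP _).
- by rewrite a1.
- by rewrite aN1.
- exact: emb_open_unit.
- apply/funext => T; rewrite phi0 !fctE -{1}(rmorph1 (emb F)) -rmorphB /= hE.
  rewrite -scalerDr -big_split big1 ?scaler0 // => i _ /=.
  by rewrite mulN1r mulNr subrr.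
have [Id IdE] := identity_op F (X := X).
have := congr1 (fun psi => psi (single_op j Id)) aE.
rewrite /= phi0 tensor_functional_single // IdE fx mulr1 /a eqxx => /eqP.
by rewrite oner_eq0.
Qed.

(** Otherwise the functional would lie strictly between zero and its multiple
    with a normalised coefficient tuple. *)
Lemma extreme_tensor_coefficients a f x :
  Pi_states F (x, f) -> lp_norm F q a <= 1 ->
  extreme_points ball (tensor_functional a f x) ->
  (exists T, tensor_functional a f x T != 0) -> lp_norm F q a = 1.
Proof.
move=> xfP a1 [_ ext] [T0 T0_neq0]; have [_ q0 _] := pq.
have [a0|a_neq0] := eqVneq (lp_norm F q a) 0.
  move: T0_neq0; rewrite /tensor_functional big1 ?eqxx // => i _.
  by rewrite (lp_norm_eq0 i q0 a0) mul0r.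
apply/eqP; rewrite eq_le a1 leNgt; apply/negP => a_lt1.
have a_gt0 : 0 < lp_norm F q a by rewrite lt_def a_neq0 lp_norm_ge0.
have [t [tE t_neq0 t1 t0]] :
    exists t, [/\ lp_norm F q a = t, t != 0, t < 1 & 0 < t].
  by exists (lp_norm F q a).
have b1 : lp_norm F q (fun i => emb F t^-1 * a i) = 1.
  by rewrite lp_normZ // rnorm_emb ger0_norm ?invr_ge0 ?(ltW t0) // tE mulVf.
have ball0 : ball 0.
  apply/(dual_ballP _ (joint_numerical_radius_seminorm d_gt0 pq)); split.
    by move=> c S T; rewrite /= scaler0 addr0.
  move=> T; rewrite (rnorm0 (F := F)).
  exact: seminorm_ge0 (joint_numerical_radius_seminorm d_gt0 pq).
have [|||_ zeroE] := ext _ _ (emb F t)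
    (tensor_functional_ball d_gt0 pq (a := fun i => emb F t^-1 * a i) xfP _)
    ball0.
- by rewrite b1.
- by rewrite emb_open_unit // t0.
- apply/funext => T; rewrite !fctE scaler0 addr0 /tensor_functional scaler_sumr.
  apply: eq_bigr => i _; rewrite -[RHS]/(emb F t * _) !mulrA -rmorphM mulfV //.
  by rewrite rmorph1 mul1r.
by move: T0_neq0; rewrite -zeroE eqxx.
Qed.

(** If [f] is a proper convex combination of two functionals of the dual ball,
    these take the value [1] at [x] as well, so they form states with [x]. *)
Lemma extreme_tensor_functional a f x j :
  Pi_states F (x, f) -> lp_norm F q a <= 1 -> a j != 0 ->
  extreme_points ball (tensor_functional a f x) ->
  extreme_points (dual_ball F (fun v : X => rnorm F v)) f.
Proof.
move=> xfP a1 aj [_ ext]; have [x1 f_lin fN fx] := (Pi_statesP _ _).1 xfP.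
split; first exact/(dual_ballP _ (@norm_seminorm _ _ F X)).
move=> g h t /(dual_ballP _ (@norm_seminorm _ _ F X))[g_lin gN].
move=> /(dual_ballP _ (@norm_seminorm _ _ F X))[h_lin hN] t01 fE.
have [r r01 tE] := open_unit_emb (F := F) t01.
have [|||gx hx] := unit_disc_extreme (F := F) (a := g x) (b := h x) r01.
- by rewrite -x1.
- by rewrite -x1.
- by rewrite -tE -[LHS]fx [in LHS]fE.
have gP : Pi_states F (x, g) by apply/Pi_statesP.
have hP : Pi_states F (x, h) by apply/Pi_statesP.
have [|gE hE] := ext _ _ t (tensor_functional_ball d_gt0 pq gP a1)
    (tensor_functional_ball d_gt0 pq hP a1) t01.
  apply/funext => T; rewrite !fctE /tensor_functional !scaler_sumr -big_split.
  apply: eq_bigr => i _; rewrite [in LHS]fE !fctE /= mulrDr.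
  by congr (_ + _); exact: mulrCA.
by split; apply: tensor_functional_inj_functional xfP _ aj _.
Qed.

Lemma extreme_tensor_point a f x j :
  Pi_states F (x, f) -> lp_norm F q a <= 1 -> a j != 0 ->
  extreme_points ball (tensor_functional a f x) ->
  extreme_points (unit_ball (fun v : X => rnorm F v)) x.
Proof.
move=> xfP a1 aj [_ ext]; have [x1 f_lin fN fx] := (Pi_statesP _ _).1 xfP.
split=> [|y z t y1 z1 t01 xE]; first by rewrite /unit_ball /= x1.
have [r r01 tE] := open_unit_emb (F := F) t01.
have [|||fy fz] := unit_disc_extreme (F := F) (a := f y) (b := f z) r01.
- exact: le_trans (fN y) y1.
- exact: le_trans (fN z) z1.
- rewrite -tE -[LHS]fx [in LHS]xE (linear_mapD f_lin).
  by rewrite (functionalZ t _ f_lin) (functionalZ (1 - t) _ f_lin).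
have state v : rnorm F v <= 1 -> f v = 1 -> Pi_states F (v, f).
  move=> v1 fv; apply/Pi_statesP; split=> //; apply/eqP; rewrite eq_le v1 /=.
  by rewrite -(rnorm1 (F := F)) -fv.
have [|yE zE] := ext _ _ t (tensor_functional_ball d_gt0 pq (state _ y1 fy) a1)
    (tensor_functional_ball d_gt0 pq (state _ z1 fz) a1) t01.
  apply/funext => T; rewrite !fctE /tensor_functional !scaler_sumr -big_split.
  apply: eq_bigr => i _ /=.
  have -> : f (T i x) = t * f (T i y) + (1 - t) * f (T i z).
    rewrite xE (bounded_op_linear (T i)).
    rewrite (linear_mapZ (bounded_op_linear (T i))) f_lin.
    by rewrite (functionalZ _ _ f_lin).
  by rewrite mulrDr; congr (_ + _); exact: mulrCA.
by split; apply: tensor_functional_inj_point xfP aj _.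
Qed.

End tensor_functionals.

Unset Implicit Arguments.

Theorem theorem2p4 (R : realType) (K : numFieldType) (F : real_or_complex R K)
  (X : completeNormedModType K)
  (X_nonzero : exists x : X, x <> 0)
  (w_norm : is_norm F (numerical_radius F X))
  (d : nat) (d_gt0 : (0 < d)%N)
  (p q : R) (p_gt1 : 1 < p) (pq : p^-1 + q^-1 = 1)
  (X_findim : finite_dimensional X) :
  extreme_points (dual_ball F (joint_numerical_radius F X d p))
    `<=` U_d F X d q.
Proof.
move=> phi phi_ext.
have p_gt0 : 0 < p by exact: lt_trans p_gt1.
have q_gt0 : 0 < q.
  have : p^-1 < 1 by rewrite invf_lt1.
  by rewrite -invr_gt0; lra.
have conj_pq : conjugate_exponents p q by split.
have phi_neq0 := extreme_nonzero d_gt0 conj_pq X_nonzero phi_ext.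
have [[x f] [xfP phi_le]] :=
  extreme_dominated_by_state d_gt0 conj_pq X_findim phi_ext phi_neq0.
have phi_lin : linear phi.
  have N_sem :=
    joint_numerical_radius_seminorm (F := F) (X := X) d_gt0 conj_pq.
  exact: ((dual_ballP _ N_sem).1 phi_ext.1).1.
have [a a_le1 phiE] :=
  tensor_of_state_dominated d_gt0 conj_pq xfP phi_lin phi_le.
rewrite phiE in phi_ext phi_neq0 *.
have a1 := extreme_tensor_coefficients d_gt0 conj_pq xfP a_le1 phi_ext phi_neq0.
have [j aj] : exists j, a j != 0.
  apply: contrapT => a0; move/eqP: a1; apply/negP.
  rewrite lt_eqF //; apply: le_lt_trans ltr01.
  apply: le_trans (lp_norm_le_sum _ d_gt0 (conjugate_exponents_sym conj_pq)) _.
  rewrite big1 // => i _; suff -> : a i = 0 by exact: rnorm0.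
  by apply/eqP; apply: contra_notT a0 => ?; exists i.
have [_ _ _ fx] := (Pi_statesP x f).1 xfP.
exists a, f, x; split=> //.
- exact: extreme_tensor_functional xfP a_le1 aj phi_ext.
- exact: extreme_tensor_point xfP a_le1 aj phi_ext.
Qed.
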